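(* Let $f_1,\dots,f_k\in\mathbb{R}[x_1,\dots,x_d]$, let $\mathcal{K}(\mathsf f)=\{x\in\mathbb{R}^d: f_1(x)\ge0,\dots,f_k(x)\ge0\}$, and let $T(\mathsf f)$ be the preordering generated by $f_1,\dots,f_k$. If the set $\mathcal{K}(\mathsf f)$ is compact, then each $T(\mathsf f)$-positive linear functional $L$ on $\mathbb{R}[x_1,\dots,x_d]$ is a $\mathcal{K}(\mathsf f)$-moment functional.
   Context: $\sum\mathbb{R}[x_1,\dots,x_d]^2$ denotes the set of finite sums of squares of polynomials. The preordering generated by $f_1,\dots,f_k$ is $T(\mathsf f)=\big\{\sum_{e\in\{0,1\}^k} f_1^{e_1}\cdots f_k^{e_k}\sigma_e:\ \sigma_e\in\sum\mathbb{R}[x_1,\dots,x_d]^2\big\}$. A linear functional $L:\mathbb{R}[x_1,\dots,x_d]\to\mathbb{R}$ is $T(\mathsf f)$-positive if $L(g)\ge0$ for all $g\in T(\mathsf f)$. For a closed set $K\subseteq\mathbb{R}^d$, $L$ is a $K$-moment functional if there is a (positive) Radon measure $\mu$ supported on $K$ such that every polynomial is $\mu$-integrable and $L(p)=\int p\,d\mu$ for all $p\in\mathbb{R}[x_1,\dots,x_d]$. *)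

(* Defs.v *)
From HB Require Import structures.
From mathcomp Require Import all_boot all_order all_algebra.
From mathcomp Require Import all_classical all_reals all_analysis.
(* Some notations of mpoly are incompatible with those of MathComp-Analysis. *)
From mathcomp.multinomials Require Export -(notations) mpoly.

Set Implicit Arguments.
Unset Strict Implicit.
Unset Printing Implicit Defensive.

Import Order.TTheory GRing.Theory Num.Theory.
Import numFieldNormedType.Exports.

Local Open Scope classical_set_scope.
Local Open Scope ring_scope.

Section Preordering.
Context {R : realType} {d k : nat}.

Definition peval (p : mpoly d R) (x : 'rV[R]_d) : R := meval (x ord0) p.

Definition sos : set (mpoly d R) :=
  [set p | exists s : seq (mpoly d R), p = \sum_(q <- s) q ^+ 2].

Definition semialgebraic_set (f : 'I_k -> mpoly d R) : set 'rV[R]_d :=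
  [set x | forall i, 0 <= peval (f i) x].

Definition preordering (f : 'I_k -> mpoly d R) : set (mpoly d R) :=
  [set p | exists2 sigma : {ffun 'I_k -> bool} -> mpoly d R,
    forall e, sos (sigma e)
    & p = \sum_(e : {ffun 'I_k -> bool})
            (\prod_(i < k) f i ^+ (e i : nat)) * sigma e].

Definition positive_on (C : set (mpoly d R)) (L : mpoly d R -> R) : Prop :=
  forall p, C p -> 0 <= L p.

End Preordering.

(* The carrier T with its Borel sigma-algebra; convertible to T. *)
Notation borelType T := (g_sigma_algebraType (@open T)).

(* Borel measures that are finite on compact sets and inner regular with respect
   to them; meant for Hausdorff T, where compact sets are Borel. *)
Definition radon {R : realType} {T : ptopologicalType}
    (mu : {measure set (borelType T) -> \bar R}) : Prop :=
  (forall C : set T, compact C -> (mu C < +oo)%E) /\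
  (forall A : set (borelType T), measurable A ->
    mu A = ereal_sup [set mu C | C in [set C : set T | compact C /\ C `<=` A]]).

(* [mu (~` K) = 0] says that mu is supported on K; it is meant for closed K,
   so that [~` K] is Borel. *)
Definition moment_functional {R : realType} {d : nat} (K : set 'rV[R]_d)
    (L : mpoly d R -> R) : Prop :=
  exists mu : {measure set (borelType 'rV[R]_d) -> \bar R},
    [/\ radon mu,
        mu (~` K) = 0%E,
        forall p, mu.-integrable setT (EFin \o peval p)
      & forall p, (L p)%:E = (\int[mu]_x (peval p x)%:E)%E].

(* Main.v *)
Require Import Defs.
From HB Require Import structures.
From mathcomp Require Import all_boot all_order all_algebra all_field.
From mathcomp Require Import all_classical all_reals all_analysis.
From mathcomp Require Import ring lra zify.
From mathcomp Require Import measurable_realfun.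
From mathcomp Require qe_rcf_th qe_rcf.

(** Three ingredients combine: an algebraic description of positivity on the
    compact set K(f), an extension of L to bounded functions, and the construction
    of a measure.

    Algebra. A T(f)-positive L is nonnegative on every polynomial p that is
    nonnegative on K(f) ([positive_functional_ge0]). If - 1 did not belong to the
    preordering generated by T(f) and - p, a prime cone P would contain both
    ([exists_prime_cone]); a prime cone is an ordering of a residue domain of
    R[x], and [prime_cone_point] turns it into a real point of K(f) where
    p <= 0. Hence p t = 1 + s with s, t in T(f) when p > 0 on K(f). Applied to
    p = N - |x|^2 with K(f) inside the open ball of radius sqrt N, such an identity
    makes T(f) archimedean ([woermann]); once T(f) is archimedean, the same kind of
    identity for any p > 0 on K(f) shows that p itself is in T(f)
    ([archimedean_positive]).

    The passage from a prime cone to a real point goes through a real closed field.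
    After pulling P back to a polynomial ring over the rationals, with additional
    variables for the finitely many coefficients involved, the residue field is
    countable and has an algebraic closure; a maximal ordered subfield of the latter
    is real closed ([real_sub_closed]), essentially because a polynomial that
    changes sign cannot divide 1 plus a weighted sum of squares. The point over this
    field is then transported to R by an elimination formula with rational
    coefficients ([sign_transfer]).

    Functional. By the Hahn-Banach argument L extends to a positive functional Lam
    on all functions bounded on K(f) ([positive_functional_extension]).

    Measure. Finite nets of K(f) of mesh going to zero give each point a sequence of
    digits, and the numbers Lam(1_A), A ranging over the cells of points with the
    same first n digits, cut the interval [0, Lam 1) into nested families of
    intervals. Sending t to the point located by the cells that contain t defines a
    map [quantile] from [0, Lam 1) to K(f), continuous off a countable set, and the
    image of Lebesgue measure represents Lam on continuous functions: over a fine
    cell a continuous function is nearly constant, and the cell and its interval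
    have the same mass ([quantile_integral]). No countable additivity of Lam is
    involved, as the additivity of the measure is inherited from Lebesgue measure. *)

Set Implicit Arguments.
Unset Strict Implicit.
Unset Printing Implicit Defensive.

Import Order.TTheory GRing.Theory Num.Theory.
Import numFieldNormedType.Exports.
Local Open Scope ring_scope.

(** * Prime cones of commutative rings *)

(** The general maximality principle needs the empty chain to be harmless;
    applying it to the sets A0 `|` X makes every chain contain A0. *)
Lemma Zorn_above (T : Type) (P : set (set T)) (A0 : set T) :
  P A0 ->
  (forall F : set (set T), (F `<=` P)%classic -> total_on F subset ->
     (exists A, F A) -> P (\bigcup_(X in F) X)%classic) ->
  exists A, [/\ (A0 `<=` A)%classic, P A &
    forall B, (A `<=` B)%classic -> P B -> B = A].
Proof.
move=> PA0 Pch.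
have [|A [PA Amax]] := @Zorn_bigcup _ [set X | P (A0 `|` X)]%classic.
  move=> F FP Ftot /=.
  have [[X FX]|F0] := pselect (exists X, F X); last first.
    rewrite (_ : (\bigcup_(X in F) X)%classic = set0) ?setU0//.
    by apply/seteqP; split => // x [X FX]; case: F0; exists X.
  have -> : (A0 `|` \bigcup_(X in F) X = \bigcup_(Y in [set A0 `|` X | X in F]) Y)%classic.
    rewrite bigcup_image; apply/seteqP; split => x.
      by case=> [A0x|[Y FY Yx]]; [exists X => //; left|exists Y => //; right].
    by case=> Y FY [|Yx]; [left|right; exists Y].
  apply: Pch; first by move=> _ [Y FY <-]; exact: FP.
  - move=> _ _ [Y FY <-] [Z FZ <-].
    by have [YZ|ZY] := Ftot _ _ FY FZ; [left|right]; exact: setUS.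
  - by exists (A0 `|` X)%classic; exists X.
exists (A0 `|` A)%classic; split => [x A0x|//|B AB PB]; first by left.
apply/seteqP; split => //.
have [//|nBA] := pselect (B `<=` A0 `|` A)%classic.
case: (Amax B) => /=; last by rewrite (setUidr _) // => x ?; apply: AB; left.
by split=> [|BA]; [move=> x ?; apply: AB; right|apply: nBA => x /BA; right].
Qed.

Section PrimeCones.
Variable A : comNzRingType.
Implicit Types (T P : set A) (x y : A).

Definition precone T := [/\ forall x, T (x ^+ 2),
  forall x y, T x -> T y -> T (x + y) & forall x y, T x -> T y -> T (x * y)].

(** The last clause says that the support, the intersection of P and - P, is a
    prime ideal. A prime cone is therefore the trace on A of a field ordering,
    namely of an ordering of the fraction field of A modulo the support. *)
Definition prime_cone P := [/\ precone P, ~ P (- 1), forall x, P x \/ P (- x)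
  & forall x y, P (x * y) -> P (- (x * y)) -> P x /\ P (- x) \/ P y /\ P (- y)].

(** The preordering generated by T and x: squares of x are absorbed in T. *)
Definition adjoin_cone T x : set A :=
  [set z | exists a b, [/\ T a, T b & z = a + x * b]].

Lemma precone0 T : precone T -> T 0.
Proof. by case=> sq _ _; have := sq 0; rewrite expr0n. Qed.

Lemma precone1 T : precone T -> T 1.
Proof. by case=> sq _ _; have := sq 1; rewrite expr1n. Qed.

Lemma adjoin_coneP T x : precone T ->
  [/\ precone (adjoin_cone T x), (T `<=` adjoin_cone T x)%classic
    & adjoin_cone T x x].
Proof.
move=> pT; have [sq add mul] := pT; have T0 := precone0 pT.
have TA : (T `<=` adjoin_cone T x)%classic.
  by move=> a Ta; exists a, 0; rewrite mulr0 addr0.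
split => //; last by exists 0, 1; rewrite mulr1 add0r; split => //; exact: precone1.
split=> [y|_ _ [a [b [Ta Tb ->]]] [c [d [Tc Td ->]]]|
  _ _ [a [b [Ta Tb ->]]] [c [d [Tc Td ->]]]]; first exact/TA/sq.
- by exists (a + c), (b + d); split; [exact: add|exact: add|ring].
- exists (a * c + x ^+ 2 * (b * d)), (a * d + b * c).
  split; last by ring.
    by apply: (add); [exact: mul|apply: (mul); [exact: sq|exact: mul]].
  by apply: (add); exact: mul.
Qed.

(** A cone that is maximal among those avoiding - 1 is prime. If neither x nor
    - x belongs to it, adjoining either of them produces - 1, and the product of
    the two resulting identities writes - 1 inside the cone itself. The support
    is prime by the same multiplication trick. *)
Lemma exists_prime_cone T : precone T -> ~ T (- 1) ->
  exists P, (T `<=` P)%classic /\ prime_cone P.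
Proof.
move=> pT T1.
have [||P [TP [pP P1] Pmax]] := @Zorn_above _ [set X | precone X /\ ~ X (- 1)] T.
- by [].
- move=> F FP Ftot [X FX] /=; split; last by case=> Y FY; exact: (FP _ FY).2.
  have up (B : A -> A -> A) : (forall Y, F Y -> forall x y, Y x -> Y y -> Y (B x y)) ->
      forall x y, (\bigcup_(X in F) X)%classic x ->
      (\bigcup_(X in F) X)%classic y -> (\bigcup_(X in F) X)%classic (B x y).
    move=> FB x y [Y FY Yx] [Z FZ Zy]; have [YZ|ZY] := Ftot _ _ FY FZ.
    - by exists Z => //; apply: FB => //; exact: YZ.
    - by exists Y => //; apply: FB => //; exact: ZY.
  split; first by move=> x; exists X => //; case: (FP _ FX) => -[].
  - by apply: up => Y FY; case: (FP _ FY) => -[].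
  - by apply: up => Y FY; case: (FP _ FY) => -[].
have pPP := pP; case: pPP => sq add mul; have Po := precone1 pP.
(* maximality: a proper extension contains -1 *)
have ext x : ~ P x -> exists a b, [/\ P a, P b & - 1 = a + x * b].
  move=> nPx; have [pPx PPx Px] := adjoin_coneP x pP.
  apply/not_notP => /= nP1; apply: nPx.
  rewrite -(Pmax _ PPx) //; split => //.
have tot x : P x \/ P (- x).
  have [|nPx] := pselect (P x); first by left.
  have [|nPNx] := pselect (P (- x)); first by right.
  have [a [b [Pa Pb e1]]] := ext _ nPx.
  have [c [d [Pc Pd e2]]] := ext _ nPNx.
  case: P1; have -> : - 1 = a + c + a * c + x ^+ 2 * (b * d).
    have h1 : x * b = - 1 - a by rewrite e1; ring.
    have h2 : x * d = 1 + c by rewrite -[1]opprK e2; ring.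
    have -> : x ^+ 2 * (b * d) = (x * b) * (x * d) by ring.
    by rewrite h1 h2; ring.
  apply: (add); first by apply: (add); [exact: add|exact: mul].
  by apply: (mul); [exact: sq|exact: mul].
have suppM z y : P z -> P (- z) -> P (z * y) /\ P (- (z * y)).
  move=> Pz PNz; have [Py|PNy] := tot y.
    by split; [exact: mul|rewrite -mulNr; exact: mul].
  by split; [rewrite -mulrNN; exact: mul|rewrite -mulrN; exact: mul].
exists P; split => //; split => // x y Pxy PNxy.
have half u : ~ (P u /\ P (- u)) ->
    exists a b, P a /\ (b * u = 1 + a \/ b * u = - (1 + a)).
  move=> /not_andP[nPu|nPu]; have [a [b [Pa _ e]]] := ext _ nPu; exists a, b;
    split => //; [right|left].
  - have -> : b * u = - 1 - a by rewrite e; ring.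
    by ring.
  - have -> : 1 + a = - (- 1) + a by rewrite opprK.
    by rewrite e; ring.
have [//|nx] := pselect (P x /\ P (- x)); first by left.
have [//|ny] := pselect (P y /\ P (- y)); first by right.
have [a [b [Pa hb]]] := half _ nx; have [c [d [Pc hd]]] := half _ ny.
have [Pz PNz] := suppM _ (b * d) Pxy PNxy.
case: P1; have Pac : P (a + c + a * c) by apply: (add); [exact: add|exact: mul].
have ez : x * y * (b * d) = (b * x) * (d * y) by ring.
rewrite ez in Pz PNz.
have [h|h] : (b * x) * (d * y) = (1 + a) * (1 + c) \/
             (b * x) * (d * y) = - ((1 + a) * (1 + c)).
  by case: hb => ->; case: hd => ->; [left|right|right|left]; ring.
- have -> : - 1 = a + c + a * c + - ((b * x) * (d * y)) by rewrite h; ring.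
  exact: add.
- have -> : - 1 = a + c + a * c + ((b * x) * (d * y)) by rewrite h; ring.
  exact: add.
Qed.

End PrimeCones.

Section PrimeConeTheory.
Variables (A : comNzRingType) (P : set A).
Hypothesis primeP : prime_cone P.
Implicit Types x y : A.

Lemma prime_cone_sqr x : P (x ^+ 2).
Proof. by case: primeP => -[]. Qed.

Lemma prime_coneD x y : P x -> P y -> P (x + y).
Proof. by case: primeP => -[? + _] _ _ _; apply. Qed.

Lemma prime_coneM x y : P x -> P y -> P (x * y).
Proof. by case: primeP => -[? _ +] _ _ _; apply. Qed.

Lemma prime_cone_total x : P x \/ P (- x).
Proof. by case: primeP. Qed.

Lemma prime_coneN1 : ~ P (- 1).
Proof. by case: primeP. Qed.

Definition support : set A := [set x | P x /\ P (- x)].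

Lemma supportD x y : support x -> support y -> support (x + y).
Proof. by move=> [? ?] [? ?]; split; rewrite ?opprD; exact: prime_coneD. Qed.

Lemma supportN x : support x -> support (- x).
Proof. by move=> [? ?]; split; rewrite ?opprK. Qed.

Lemma supportMl y x : support x -> support (y * x).
Proof.
move=> [Px PNx]; have [Py|PNy] := prime_cone_total y.
  by split; [exact: prime_coneM|rewrite -mulrN; exact: prime_coneM].
by split; [rewrite -mulrNN; exact: prime_coneM|rewrite -mulNr; exact: prime_coneM].
Qed.

Lemma support_prime x y : support (x * y) -> support x \/ support y.
Proof. by case: primeP => _ _ _ + []; apply. Qed.

Lemma support0 : support 0.
Proof.
have h : P 0 by have := prime_cone_sqr 0; rewrite expr0n.
by split; rewrite ?oppr0.
Qed.

Lemma support1 : ~ support 1.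
Proof. by case=> _ /prime_coneN1. Qed.

Lemma prime_cone_supp x y : support (x - y) -> P x -> P y.
Proof.
move=> [_ h] Px; have -> : y = x + - (x - y) by ring.
exact: prime_coneD.
Qed.

End PrimeConeTheory.

(** * Real closed subfields of an algebraically closed field *)

Section OrderedCones.
Variable K : closedFieldType.
Implicit Types (C : set K) (x y : K).

(** The nonnegative elements of an ordered subring of K. *)
Definition ordered_cone C := [/\ C 1,
  forall x y, C x -> C y -> C (x + y), forall x y, C x -> C y -> C (x * y),
  forall x, C x -> C (- x) -> x = 0 &
  forall x y, C x -> C y -> C (x - y) \/ C (y - x)].

(** A maximal ordered cone is a structure rather than a hypothesis, so that the
    subfield it determines can carry canonical algebraic instances. *)
Record maximal_cone := MaximalCone { cone_set :> K -> Prop;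
  maximal_cone_ordered : ordered_cone cone_set;
  maximal_cone_max : forall C, (cone_set `<=` C)%classic -> ordered_cone C ->
    C = cone_set }.

Lemma exists_maximal_cone C0 : ordered_cone C0 ->
  exists C : maximal_cone, (C0 `<=` cone_set C)%classic.
Proof.
move=> oC0; have [||C [C0C oC Cmax]] := @Zorn_above _ ordered_cone C0.
- by [].
- move=> F Fo Ftot [X FX].
  have two (Q : K -> K -> set K -> Prop) : (forall Y, F Y ->
       forall x y, Y x -> Y y -> Q x y Y) ->
      forall x y, (\bigcup_(X in F) X)%classic x ->
      (\bigcup_(X in F) X)%classic y -> exists2 Y, F Y & Q x y Y.
    move=> FB x y [Y FY Yx] [Z FZ Zy]; have [YZ|ZY] := Ftot _ _ FY FZ.
    - by exists Z => //; apply: FB => //; exact: YZ.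
    - by exists Y => //; apply: FB => //; exact: ZY.
  split; first by exists X => //; case: (Fo _ FX).
  + move=> x y xF yF; have [|Y FY h] := two (fun x y Y => Y (x + y)) _ x y xF yF.
      by move=> Y /Fo[].
    by exists Y.
  + move=> x y xF yF; have [|Y FY h] := two (fun x y Y => Y (x * y)) _ x y xF yF.
      by move=> Y /Fo[].
    by exists Y.
  + move=> x xF yF; have [|Y FY <-//] := two (fun x y Y => y = - x -> x = 0) _ x _ xF yF.
    by move=> Y /Fo[_ _ _ h _] z w Yz Yw e; apply: h => //; rewrite -e.
  + move=> x y xF yF; have [|Y FY] := two (fun x y Y => Y (x - y) \/ Y (y - x)) _ x y xF yF.
      by move=> Y /Fo[].
    by case=> h; [left|right]; exists Y.
exists (MaximalCone oC (fun D CD oD => Cmax D CD oD)).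
exact: C0C.
Qed.

Lemma ordered_cone0 C : ordered_cone C -> C 0.
Proof. by case=> c1 _ _ _ tot; have := tot _ _ c1 c1; rewrite subrr => -[]. Qed.

(** Maximality makes the ordered subring a field: the fractions with denominators
    in C form an ordered cone again. *)
Lemma maximal_cone_div (C : maximal_cone) x y : C y -> y != 0 -> C (x * y) -> C x.
Proof.
move=> Cy y0 Cxy; have oC := maximal_cone_ordered C; have oC' := oC.
case: oC' => c1 add mul anti tot.
rewrite -(@maximal_cone_max C [set u | exists v, [/\ C v, v != 0 & C (u * v)]]%classic).
- by exists y.
- by move=> u Cu; exists 1; rewrite mulr1 oner_neq0.
split.
- by exists 1; rewrite mulr1 oner_neq0.
- move=> u u' [v [Cv v0 Cuv]] [v' [Cv' v'0 Cuv']]; exists (v * v').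
  rewrite mulf_neq0//; split => //; first exact: mul.
  have -> : (u + u') * (v * v') = u * v * v' + u' * v' * v by ring.
  by apply: (add); exact: mul.
- move=> u u' [v [Cv v0 Cuv]] [v' [Cv' v'0 Cuv']]; exists (v * v').
  rewrite mulf_neq0//; split => //; first exact: mul.
  have -> : (u * u') * (v * v') = (u * v) * (u' * v') by ring.
  exact: mul.
- move=> u [v [Cv v0 Cuv]] [v' [Cv' v'0 Cuv']].
  have : u * v * v' = 0.
    apply: anti; first exact: mul.
    have -> : - (u * v * v') = (- u * v') * v by ring.
    exact: mul.
  by move/eqP; rewrite !mulf_eq0 (negPf v0) (negPf v'0) !orbF => /eqP.
- move=> u u' [v [Cv v0 Cuv]] [v' [Cv' v'0 Cuv']].
  have := tot _ _ (mul _ _ Cuv Cv') (mul _ _ Cuv' Cv).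
  have -> : u * v * v' - u' * v' * v = (u - u') * (v * v') by ring.
  have -> : u' * v' * v - u * v * v' = (u' - u) * (v * v') by ring.
  by case=> h; [left|right]; exists (v * v'); rewrite mulf_neq0//; split => //;
    exact: mul.
Qed.

Definition real_pred (C : maximal_cone) : {pred K} :=
  fun x => `[< C x \/ C (- x) >].

Lemma real_predP (C : maximal_cone) x : reflect (C x \/ C (- x)) (x \in real_pred C).
Proof. exact: asboolP. Qed.

Lemma real_pred_divring_closed (C : maximal_cone) : divring_closed (real_pred C).
Proof.
have oC := maximal_cone_ordered C; case: (oC) => c1 add mul anti tot.
have rM x y : x \in real_pred C -> y \in real_pred C -> x * y \in real_pred C.
  move=> /real_predP[Cx|Cx] /real_predP[Cy|Cy]; apply/real_predP.
  - by left; exact: mul.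
  - by right; rewrite -mulrN; exact: mul.
  - by right; rewrite -mulNr; exact: mul.
  - by left; rewrite -mulrNN; exact: mul.
split.
- by apply/real_predP; left.
- move=> x y /real_predP[Cx|Cx] /real_predP[Cy|Cy]; apply/real_predP.
  + by case: (tot _ _ Cx Cy) => ?; [left|right; rewrite opprB].
  + by left; exact: add.
  + by right; rewrite opprB addrC; exact: add.
  + by have := tot _ _ Cx Cy; rewrite !opprK => -[h|h]; [right; rewrite opprB addrC|left; rewrite addrC].
- move=> x y xr yr; apply: rM => //; have [->|y0] := eqVneq y 0.
    by rewrite invr0; apply/real_predP; left; exact: ordered_cone0.
  have e1 : y^-1 * y = 1 by rewrite mulVf.
  have e2 : - y^-1 * - y = 1 by rewrite mulrNN.
  apply/real_predP; move/real_predP: yr => [Cy|Cy]; [left|right].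
  - by apply: (maximal_cone_div Cy y0); rewrite e1.
  - by apply: (maximal_cone_div Cy); rewrite ?oppr_eq0// e2.
Qed.

HB.instance Definition _ (C : maximal_cone) := GRing.isDivringClosed.Build K (real_pred C)
  (real_pred_divring_closed C).

Record real_sub (C : maximal_cone) := RealSub { rval : K; _ : rval \in real_pred C }.
HB.instance Definition _ (C : maximal_cone) := [isSub for @rval C].
HB.instance Definition _ (C : maximal_cone) := [Choice of real_sub C by <:].
HB.instance Definition _ (C : maximal_cone) := [SubChoice_isSubComUnitRing of real_sub C by <:].
HB.instance Definition _ (C : maximal_cone) := [SubComUnitRing_isSubIntegralDomain of real_sub C by <:].
HB.instance Definition _ (C : maximal_cone) := [SubIntegralDomain_isSubField of real_sub C by <:].

Section RealSubOrder.
Variable C : maximal_cone.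
Implicit Types u v : real_sub C.

Definition rs_le u v := `[< C (val (v - u)) >].
Definition rs_lt u v := (v != u) && rs_le u v.
Definition rs_norm u := if rs_le 0 u then u else - u.

Lemma rs_le0 u : rs_le 0 u = `[< C (val u) >].
Proof. by rewrite /rs_le subr0. Qed.

Lemma rs_ge0 u : rs_le u 0 = `[< C (- val u) >].
Proof. by rewrite /rs_le sub0r rmorphN. Qed.

Lemma rs_le0_add u v : rs_le 0 u -> rs_le 0 v -> rs_le 0 (u + v).
Proof.
rewrite !rs_le0 rmorphD => /asboolP Cu /asboolP Cv; apply/asboolP.
by case: (maximal_cone_ordered C) => _ + _ _ _; apply.
Qed.

Lemma rs_le0_mul u v : rs_le 0 u -> rs_le 0 v -> rs_le 0 (u * v).
Proof.
rewrite !rs_le0 rmorphM => /asboolP Cu /asboolP Cv; apply/asboolP.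
by case: (maximal_cone_ordered C) => _ _ + _ _; apply.
Qed.

Lemma rs_le0_anti u : rs_le 0 u -> rs_le u 0 -> u = 0.
Proof.
rewrite rs_le0 rs_ge0 => /asboolP Cu /asboolP Cv; apply: val_inj.
by rewrite rmorph0; case: (maximal_cone_ordered C) => _ _ _ + _; apply.
Qed.

Lemma rs_sub_ge0 u v : rs_le 0 (v - u) = rs_le u v.
Proof. by rewrite /rs_le subr0. Qed.

Lemma rs_le0_total u : rs_le 0 u || rs_le u 0.
Proof.
rewrite rs_le0 rs_ge0; have /real_predP[h|h] := valP u; apply/orP; [left|right]; exact/asboolP.
Qed.

Lemma rs_normN u : rs_norm (- u) = rs_norm u.
Proof.
rewrite /rs_norm; have -> : rs_le 0 (- u) = rs_le u 0 by rewrite rs_le0 rs_ge0 rmorphN.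
have := @rs_le0_anti u; have := rs_le0_total u.
case: (rs_le 0 u); case: (rs_le u 0); rewrite ?opprK//= => _ h.
by rewrite h// oppr0.
Qed.

Lemma rs_ge0_norm u : rs_le 0 u -> rs_norm u = u.
Proof. by rewrite /rs_norm => ->. Qed.

HB.instance Definition _ := Num.IntegralDomain_isLeReal.Build (real_sub C)
  rs_le0_add rs_le0_mul rs_le0_anti rs_sub_ge0 rs_le0_total rs_normN rs_ge0_norm
  (fun u v => erefl (rs_lt u v)).

Lemma real_sub_ge0 u : (0 <= u) = `[< C (val u) >].
Proof. exact: rs_le0. Qed.

End RealSubOrder.
End OrderedCones.

Section SignChange.
Variable F : realFieldType.
Implicit Types (p : {poly F}) (s : seq (F * {poly F})).

(** The coefficients of the squares are kept as separate weights because a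
    nonnegative element of an ordered field need not be a square. *)
Definition wsos s : {poly F} := \sum_(x <- s) x.1 *: x.2 ^+ 2.

(** Descent on the degree of p. After reduction of the squared polynomials modulo
    p, the cofactor g in 1 + wsos s = g * p has smaller degree than p, divides a
    sum of the same form, and changes sign with p since the left side is positive
    at a and at b. *)
Lemma wsos_sign_change p s a b : all (fun x => 0 <= x.1) s ->
  p.[a] * p.[b] < 0 -> ~ p %| 1 + wsos s.
Proof.
have [n] := ubnP (size p); elim: n p s => // n IHn p s.
rewrite ltnS => szp s0 pab pdvd.
have p0 : p != 0 by apply: contraTneq pab => ->; rewrite !horner0 mul0r ltxx.
have sp1 : (1 < size p)%N.
  rewrite ltnNge; apply: contraTN pab => /size1_polyC ->.
  by rewrite !hornerC -leNgt -expr2 sqr_ge0.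
pose s' := [seq (x.1, x.2 %% p) | x <- s].
have s'0 : all (fun x => 0 <= x.1) s' by rewrite all_map.
have pdvd' : p %| 1 + wsos s'.
  have -> : 1 + wsos s' = (1 + wsos s) - (wsos s - wsos s') by ring.
  rewrite dvdp_subr//; rewrite /wsos big_map -sumrB.
  apply: (big_ind (fun z => p %| z)) => [|x y hx hy|x _]; [exact: dvdp0|by rewrite dvdp_addr|].
  rewrite -scalerBr subr_sqr {1}(divp_eq x.2 p) addrK.
  have [->|x0] := eqVneq x.1 0; first by rewrite scale0r dvdp0.
  by rewrite dvdpZr// dvdp_mulr// dvdp_mull.
pose g := (1 + wsos s') %/ p.
have eg : 1 + wsos s' = g * p by rewrite divpK.
have pos x : 0 < (1 + wsos s').[x].
  rewrite hornerD hornerC (lt_le_trans ltr01)// lerDl /wsos big_map horner_sum.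
  rewrite big_seq; apply: sumr_ge0 => y ys.
  rewrite hornerZ horner_exp; apply: mulr_ge0; [exact: (allP s0 y ys)|exact: sqr_ge0].
have g0 : g != 0.
  by apply: contraTneq (pos 0) => g0; rewrite eg g0 mul0r horner0 ltxx.
have szs : (size (1 + wsos s')%R <= (size p).*2 - 3)%N.
  rewrite (leq_trans (size_polyD _ _))// geq_max size_poly1.
  apply/andP; split; first by lia.
  rewrite /wsos big_map (leq_trans (size_sum _ _ _))//.
  apply/bigmax_leqP_seq => x _ _.
  rewrite (leq_trans (size_scale_leq _ _))//.
  rewrite expr2 (leq_trans (size_polyMleq _ _))//.
  have h : (size (x.2 %% p)%R < size p)%N by rewrite ltn_modp.
  have arith (u v : nat) : (u < v -> 1 < v -> (u + u).-1 <= v.*2 - 3)%N by lia.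
  exact: arith.
have szg : (size g < size p)%N.
  have arith (u v : nat) : ((u + v).-1 <= v.*2 - 3 -> 1 < v -> u < v)%N by lia.
  by apply: arith => //; rewrite -size_mul// -eg.
apply: (IHn g s' _ s'0 _).
- by rewrite (leq_trans szg).
- have := pos a; have := pos b; rewrite eg !hornerM => hb ha.
  have := mulr_gt0 ha hb; rewrite mulrACA nmulr_lgt0//.
- by rewrite eg dvdp_mulr.
Qed.
End SignChange.

Section RealSubClosed.
Variables (K : closedFieldType) (C : maximal_cone K).
Local Notation M := (real_sub C).
Implicit Types p : {poly M}.

(** By the previous lemma p generates with the nonnegative constants a proper
    preordering of the polynomials over M. A prime cone above it has a support
    generated by some q, which has a root al in K; evaluation at al carries the
    prime cone to an ordered cone containing C. By maximality al is already in M,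
    and p vanishes there because p belongs to the support. *)
Lemma sign_change_root p (a b : M) : p.[a] * p.[b] < 0 -> exists r, root p r.
Proof.
move=> pab; pose T : set {poly M} :=
  [set z | exists s g, all (fun x => 0 <= x.1) s /\ z = wsos s + g * p]%classic.
have pT : precone T.
  split.
  - move=> x; exists [:: (1, x)], 0; rewrite /= ler01; split=> //.
    by rewrite /wsos big_seq1 scale1r mul0r addr0.
  - move=> _ _ [s [g [s0 ->]]] [s' [g' [s'0 ->]]].
    exists (s ++ s'), (g + g'); rewrite all_cat s0 s'0; split => //.
    by rewrite /wsos big_cat /=; ring.
  - move=> _ _ [s [g [s0 ->]]] [s' [g' [s'0 ->]]].
    exists [seq (x.1 * y.1, x.2 * y.2) | x <- s, y <- s'].
    exists (wsos s * g' + g * wsos s' + g * g' * p); split.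
      apply/allP => _ /allpairsP[[x y] [xs ys ->]] /=.
      by apply: mulr_ge0; [exact: (allP s0 x xs)|exact: (allP s'0 y ys)].
    rewrite [wsos [seq _ | _ <- _, _ <- _]]/wsos big_allpairs_dep.
    rewrite (_ : \sum_(i <- s) _ = wsos s * wsos s'); first by ring.
    rewrite /wsos mulr_suml; apply: eq_bigr => x _; rewrite mulr_sumr.
    by apply: eq_bigr => y _; rewrite exprMn -scalerAl -scalerAr scalerA.
have nT : ~ T (- 1).
  move=> [s [g [s0 e]]]; apply: (wsos_sign_change s0 pab).
  have -> : 1 + wsos s = - g * p.
    have -> : wsos s = (wsos s + g * p) - g * p by ring.
    by rewrite -e; ring.
  exact: dvdp_mull.
have [P [TP Pp]] := exists_prime_cone pT nT.
have PT s g : all (fun x => 0 <= x.1) s -> P (wsos s + g * p).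
  by move=> s0; apply: TP; exists s, g.
have suppp : support P p.
  split; [have := PT [::] 1|have := PT [::] (- 1)]; rewrite /wsos big_nil add0r.
    by rewrite mul1r; apply.
  by rewrite mulN1r; apply.
have Pc (c : M) : 0 <= c -> P c%:P.
  move=> c0; have := PT [:: (c, 1)] 0; rewrite /wsos big_seq1 mul0r addr0 /=.
  by rewrite expr1n c0 alg_polyC; apply.
have p0 : p != 0 by apply: contraTneq pab => ->; rewrite !horner0 mul0r ltxx.
(* an element of least degree in the support generates it *)
have [q [q0 suppq qmin]] : exists q, [/\ q != 0, support P q &
    forall g, support P g -> g != 0 -> (size q <= size g)%N].
  have ex : exists n, `[< exists q, [/\ q != 0, support P q & size q = n] >].
    by exists (size p); apply/asboolP; exists p.
  case: (ex_minnP ex) => n /asboolP[q [q0 sq <-]] h; exists q; split => // g sg g0.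
  by apply: h; apply/asboolP; exists g.
have qdvd g : support P g -> q %| g.
  move=> sg; apply/modp_eq0P; apply/eqP; apply: contraT => r0.
  have sr : support P (g %% q).
    have -> : g %% q = g - g %/ q * q by rewrite {2}(divp_eq g q); ring.
    by apply: supportD => //; apply: supportN => //; apply: supportMl.
  by have := qmin _ sr r0; rewrite leqNgt ltn_modp q0.
have sq1 : size q != 1%N.
  apply/negP => /size_poly1P[c c0 qc]; apply: (support1 Pp).
  have -> : 1 = c^-1%:P * q by rewrite qc -polyCM mulVf.
  exact: supportMl.
pose v := (\val : M -> K).
have [al /rootP qal] : exists al, root (map_poly v q) al.
  by apply/closed_rootP; rewrite size_map_poly.
pose ev g := (map_poly v g).[al].
have evD g h : ev (g + h) = ev g + ev h by rewrite /ev rmorphD hornerD.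
have evM g h : ev (g * h) = ev g * ev h by rewrite /ev rmorphM hornerM.
have evN g : ev (- g) = - ev g by rewrite /ev rmorphN hornerN.
have evC c : ev c%:P = v c by rewrite /ev map_polyC hornerC.
have evX : ev 'X = al by rewrite /ev map_polyX hornerX.
have ev0 g : support P g -> ev g = 0.
  by move=> /qdvd/dvdpP[h ->]; rewrite evM [ev q]qal mulr0.
have supp_ev g : ev g = 0 -> support P g.
  move=> eg; have [[u w] /= uw] := Bezoutp q g.
  have rg : ev (gcdp q g) = 0.
    have /dvdpP[h ->] : u * q + w * g %| gcdp q g by move: uw => /eqp_dvdl ->.
    by rewrite evM evD !evM [ev q]qal eg !mulr0 addr0 mulr0.
  have g0 : gcdp q g != 0 by rewrite gcdp_eq0 negb_and q0.
  have /dvdpP[h qh] := dvdp_gcdl q g.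
  have h0 : h != 0 by apply: contraNneq q0 => h0; rewrite qh h0 mul0r.
  have sg1 : (1 < size (gcdp q g))%N.
    rewrite ltnNge; apply/negP => /size1_polyC gc.
    have c0 : (gcdp q g)`_0 = 0.
      by apply: val_inj; rewrite -[LHS]evC -gc rg rmorph0.
    by move: g0; rewrite gc c0 eqxx.
  have /dvdpP[h' ->] := dvdp_gcdr q g; apply: supportMl => //.
  have := suppq; rewrite {1}qh => /(support_prime Pp)[sh|//].
  have := qmin _ sh h0; rewrite {1}qh size_mul// leqNgt; case/negP.
  have arith (m n : nat) : (0 < m -> 1 < n -> m < (m + n).-1)%N by lia.
  by apply: arith => //; rewrite size_poly_gt0.
have oC := maximal_cone_ordered C.
have eC : [set ev g | g in P]%classic = cone_set C :> set K.
  apply: maximal_cone_max.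
  - move=> x Cx; have xr : x \in real_pred C by apply/real_predP; left.
    exists (RealSub xr)%:P; last by rewrite evC.
    by apply: Pc; rewrite real_sub_ge0; apply/asboolP.
  - split.
    + exists 1; last by rewrite -[1]/(1%:P) evC /v rmorph1.
      by have := prime_cone_sqr Pp 1; rewrite expr1n.
    + by move=> _ _ [g Pg <-] [h Ph <-]; exists (g + h); [exact: prime_coneD|].
    + by move=> _ _ [g Pg <-] [h Ph <-]; exists (g * h); [exact: prime_coneM|].
    + move=> _ [g Pg <-] [h Ph hg]; apply: ev0; split => //.
      have sgh : support P (h - - g).
        by apply: supp_ev; rewrite evD !evN opprK hg addrC subrr.
      exact: (prime_cone_supp Pp sgh).
    + move=> _ _ [g Pg <-] [h Ph <-]; have [k|k] := prime_cone_total Pp (g - h).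
        by left; exists (g - h) => //; rewrite evD evN.
      by right; exists (h - g); [rewrite -opprB|rewrite evD evN].
have alr : al \in real_pred C.
  apply/real_predP; rewrite -eC; have [k|k] := prime_cone_total Pp 'X.
    by left; exists 'X.
  by right; exists (- 'X) => //; rewrite evN evX.
exists (RealSub alr); apply/rootP; apply: val_inj.
have := ev0 _ suppp; rewrite /ev -[al]/(v (RealSub alr)) horner_map => ->.
by rewrite rmorph0.
Qed.

(** A root that falls outside [a, b] is divided out; this preserves the sign change
    and lowers the degree. *)
Lemma real_sub_closed : Num.real_closed_axiom M.
Proof.
have key n (p : {poly M}) a b : (size p <= n)%N -> a <= b -> p.[a] * p.[b] < 0 ->
    exists2 x : M, a <= x <= b & root p x.
  elim: n p => [|n IHn] p sp ab pab.
    move: sp pab; rewrite leqn0 size_poly_eq0 => /eqP ->.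
    by rewrite horner0 mul0r ltxx.
  have [r /rootP rp] := sign_change_root pab.
  have [rab|rab] := boolP (a <= r <= b); first by exists r => //; exact/rootP.
  have /factor_theorem[g eg] : root p r by apply/rootP.
  have g0 : g != 0.
    by apply: contraTneq pab => g0; rewrite eg g0 mul0r !horner0 mul0r ltxx.
  have [||x xab xg] := IHn g _ ab; last first.
  - by exists x => //; rewrite eg rootM xg.
  - move: pab; rewrite eg !hornerM !hornerXsubC mulrACA pmulr_llt0//.
    by move: rab; rewrite negb_and -!ltNge => /orP[h|h];
       [rewrite mulr_gt0 ?subr_gt0//; exact: lt_le_trans ab
       |rewrite -mulrNN mulr_gt0 ?oppr_gt0 ?subr_lt0//; exact: le_lt_trans h].
  - by move: sp; rewrite eg size_mul ?polyXsubC_eq0// size_XsubC addn2.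
move=> p a b ab /andP[pa pb].
have [/eqP pa0|pa0] := boolP (p.[a] == 0); first by exists a => //; [rewrite lexx|exact/rootP].
have [/eqP pb0|pb0] := boolP (p.[b] == 0); first by exists b => //; [rewrite ab lexx|exact/rootP].
apply: (key (size p)) => //; rewrite nmulr_rlt0.
- by rewrite lt_def pb0 pb.
- by rewrite lt_def eq_sym pa0 pa.
Qed.

HB.instance Definition _ := Num.RealField_isClosed.Build M real_sub_closed.

End RealSubClosed.

(** * Prime cones as traces of real closed fields *)

Section Embedding.
Variable A : countComNzRingType.

Record prime_cone_of := PrimeConeOf { pcone :> A -> Prop; pconeP : prime_cone pcone }.
Variable P : prime_cone_of.

Definition supp_pred : {pred A} := fun x => `[< support P x >].

Lemma supp_predP x : reflect (support P x) (x \in supp_pred).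
Proof. exact: asboolP. Qed.

Lemma supp_idealr_closed : idealr_closed supp_pred.
Proof.
split; first by apply/supp_predP; exact: (support0 (pconeP P)).
  by apply/negP => /supp_predP; exact: (support1 (pconeP P)).
move=> a x y /supp_predP sx /supp_predP sy; apply/supp_predP.
by apply: (supportD (pconeP P)) => //; exact: (supportMl (pconeP P)).
Qed.

Lemma supp_prime_idealr_closed : prime_idealr_closed supp_pred.
Proof.
move=> x y /supp_predP /(support_prime (pconeP P))[h|h]; apply/orP; [left|right];
  exact/supp_predP.
Qed.

HB.instance Definition _ := isIdealr.Build A supp_pred supp_idealr_closed.
HB.instance Definition _ :=
  isPrimeIdealrClosed.Build A supp_pred supp_prime_idealr_closed.

(** A domain because the support is prime; inverses of its units are chosen
    classically. *)
Definition residue := {ideal_quot supp_pred}.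
HB.instance Definition _ := GRing.ComNzRing.on residue.

Definition residue_unit : {pred residue} := fun x => `[< exists y, y * x = 1 >].
Definition residue_inv (x : residue) : residue :=
  if pselect (exists y, y * x = 1) is left e then projT1 (cid e) else x.

Lemma residue_mulVx : {in residue_unit, left_inverse 1 residue_inv *%R}.
Proof.
move=> x /asboolP xu; rewrite /residue_inv; case: pselect => // e.
exact: (projT2 (cid e)).
Qed.

Lemma residue_unitPl x y : y * x = 1 -> x \in residue_unit.
Proof. by move=> yx; apply/asboolP; exists y. Qed.

Lemma residue_invr_out : {in [predC residue_unit], residue_inv =1 id}.
Proof.
move=> x /negP xu; rewrite /residue_inv; case: pselect => // e.
by case: xu; apply/asboolP.
Qed.

HB.instance Definition _ := GRing.ComNzRing_hasMulInverse.Build residue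
  residue_mulVx residue_unitPl residue_invr_out.
HB.instance Definition _ := GRing.ComUnitRing_isIntegral.Build residue
  (@Quotient.rquot_IdomainAxiom A supp_pred).

Definition residue_pickle (x : residue) := pickle (repr x).
Definition residue_unpickle n : option residue :=
  omap (fun a => (\pi_residue a)%qT) (unpickle n).
Lemma residue_pickleK : pcancel residue_pickle residue_unpickle.
Proof. by move=> x; rewrite /residue_unpickle pickleK /= reprK. Qed.
HB.instance Definition _ := Choice_isCountable.Build residue residue_pickleK.

HB.instance Definition _ := [Countable of {ratio residue} by <:].
Definition residue_field := {fraction residue}.
HB.instance Definition _ := GRing.Field.on residue_field.
Definition rfield_pickle (x : residue_field) := pickle (repr x : {ratio residue}).
Definition rfield_unpickle n : option residue_field :=
  omap (fun a : {ratio residue} => (\pi_residue_field a)%qT) (unpickle n).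
Lemma rfield_pickleK : pcancel rfield_pickle rfield_unpickle.
Proof. by move=> x; rewrite /rfield_unpickle pickleK /= reprK. Qed.
HB.instance Definition _ := Choice_isCountable.Build residue_field rfield_pickleK.

(** The fraction field of the residue domain is countable, hence has an algebraic
    closure K. A maximal ordered cone of K containing the image of P defines a real
    closed subfield. An element a outside P does not become nonnegative: - a is in P,
    so the image of a would be zero and a would lie in the support. *)
Theorem real_closed_embedding :
  exists (M : rcfType) (psi : {rmorphism A -> M}), forall a, 0 <= psi a <-> P a.
Proof.
have [K [FK _]] := countable_algebraic_closure residue_field.
pose proj : {rmorphism A -> residue} := \pi_residue%qT.
pose phi : {rmorphism A -> K} := FK \o (@FracField.tofrac residue) \o proj.
have phi0 a : phi a = 0 <-> support P a.
  rewrite /phi /=; split.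
    move/eqP; rewrite fmorph_eq0 tofrac_eq0 => /eqP pa.
    apply/supp_predP; rewrite -[a]subr0 Quotient.idealrBE.
    apply/eqP; change (proj a = proj 0); rewrite rmorph0; exact: pa.
  move=> /supp_predP; rewrite -[a in a \in _]subr0 Quotient.idealrBE => /eqP pa.
  rewrite (_ : \pi_residue a = 0)%qT ?rmorph0//; rewrite -(rmorph0 proj); exact: pa.
have pP := pconeP P.
have [|C PC] := @exists_maximal_cone K [set phi a | a in (P : set A)]%classic.
  split.
  - exists 1; last by rewrite rmorph1.
    by have := prime_cone_sqr pP 1; rewrite expr1n.
  - by move=> _ _ [a Pa <-] [b Pb <-]; exists (a + b); [exact: prime_coneD|rewrite rmorphD].
  - by move=> _ _ [a Pa <-] [b Pb <-]; exists (a * b); [exact: prime_coneM|rewrite rmorphM].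
  - move=> _ [a Pa <-] [b Pb ba]; apply/phi0; split => //.
    have sab : support P (b - - a).
      by apply/phi0; rewrite opprK rmorphD ba addNr.
    exact: (prime_cone_supp pP sab).
  - move=> _ _ [a Pa <-] [b Pb <-]; have [k|k] := prime_cone_total pP (a - b).
      by left; exists (a - b) => //; rewrite rmorphB.
    by right; exists (b - a); [rewrite -opprB|rewrite rmorphB].
have phiC a : P a -> cone_set C (phi a) by move=> Pa; apply: PC; exists a.
have phir a : phi a \in real_pred C.
  apply/real_predP; have [k|k] := prime_cone_total pP a; first by left; exact: phiC.
  by right; rewrite -rmorphN; exact: phiC.
pose psi a : real_sub C := RealSub (phir a).
have psiD : zmod_morphism psi by move=> a b; apply: val_inj; exact: (rmorphB phi).
have psiM : monoid_morphism psi.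
  split=> [|a b]; apply: val_inj; [exact: (rmorph1 phi)|exact: (rmorphM phi)].
pose psiA := GRing.isZmodMorphism.Build A (real_sub C) psi psiD.
pose psiMM := GRing.isMonoidMorphism.Build A (real_sub C) psi psiM.
pose Psi : {rmorphism A -> real_sub C} := HB.pack psi psiA psiMM.
exists (real_sub C), Psi; move=> a; rewrite real_sub_ge0; split=> [/asboolP /= Ca|Pa].
  have [//|PNa] := prime_cone_total pP a.
  have [_ _ _ anti _] := maximal_cone_ordered C.
  have /phi0[//] : phi a = 0 by apply: anti => //; rewrite -rmorphN; exact: phiC.
by apply/asboolP; exact: phiC.
Qed.

End Embedding.

(** * Elimination formulas under change of field *)

(** Quantifier elimination produces a formula with coefficients in the ground
    field. To compare two real closed fields the formula has to be the same for
    both, so it is computed once over the rationals; the lemmas of this section say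
    that every stage of the computation commutes with a change of ground field.
    The stages are written in continuation passing style, which is why the
    statements relate two continuations k and k'. *)
Section FormulaMap.
Variables (F G : realFieldType) (h : {rmorphism F -> G}).
Import qe_rcf.

Fixpoint map_term (t : term F) : term G :=
  match t with
  | Var i => Var G i
  | Const c => Const (h c)
  | NatConst n => NatConst G n
  | Add a b => Add (map_term a) (map_term b)
  | Opp a => Opp (map_term a)
  | NatMul a n => NatMul (map_term a) n
  | Mul a b => Mul (map_term a) (map_term b)
  | Exp a n => Exp (map_term a) n
  end.

Fixpoint map_formula (f : formula F) : formula G :=
  match f with
  | Bool b => Bool b
  | Equal a b => Equal (map_term a) (map_term b)
  | Lt a b => Lt (map_term a) (map_term b)
  | Le a b => Le (map_term a) (map_term b)
  | And f1 f2 => And (map_formula f1) (map_formula f2)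
  | Or f1 f2 => Or (map_formula f1) (map_formula f2)
  | Implies f1 f2 => Implies (map_formula f1) (map_formula f2)
  | Not f1 => Not (map_formula f1)
  end.

Local Notation mt := map_term.
Local Notation mf := map_formula.
Local Notation mp := (map map_term).

Lemma map_Size p k : mf (Size p k) = Size (mp p) (fun n => mf (k n)).
Proof.
elim: p k => //= c p IHp k; rewrite /bind_def IHp; congr (Size _ _).
by apply/funext => -[|n].
Qed.

Lemma map_Isnull p k : mf (Isnull p k) = Isnull (mp p) (fun b => mf (k b)).
Proof. exact: map_Size. Qed.

Lemma map_LeadCoef p k k' : (forall c, mf (k c) = k' (mt c)) ->
  mf (LeadCoef p k) = LeadCoef (mp p) k'.
Proof.
elim: p k k' => [|c p IHp] k k' kk' /=; first by rewrite kk' /= rmorph0.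
by apply: IHp => l /=; rewrite !kk'.
Qed.

Lemma map_AmulXn a n : mp (AmulXn a n) = AmulXn (mt a) n.
Proof. by elim: n => //= n ->; rewrite rmorph0. Qed.

Lemma map_AddPoly p q : mp (AddPoly p q) = AddPoly (mp p) (mp q).
Proof. by elim: p q => [|a p IHp] [|b q] //=; rewrite IHp. Qed.

Lemma map_ScalPoly c p : mp (ScalPoly c p) = ScalPoly (mt c) (mp p).
Proof. by rewrite /ScalPoly -!map_comp; apply: eq_map. Qed.

Lemma map_MulPoly p q : mp (MulPoly p q) = MulPoly (mp p) (mp q).
Proof. by elim: p q => //= a p IHp q; rewrite map_AddPoly map_ScalPoly /= IHp. Qed.

Lemma map_ExpPoly p n : mp (ExpPoly p n) = ExpPoly (mp p) n.
Proof.
by case: n => //= n; elim: n => //= n IHn; rewrite /ExpPoly /= map_MulPoly IHn.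
Qed.

Lemma map_OppPoly p : mp (OppPoly p) = OppPoly (mp p).
Proof. by rewrite /OppPoly map_ScalPoly /= rmorphN1. Qed.

Lemma map_NatMulPoly n p : mp (NatMulPoly n p) = NatMulPoly n (mp p).
Proof. exact: map_ScalPoly. Qed.

Lemma map_Deriv p : mp (Deriv p) = Deriv (mp p).
Proof. by elim: p => //= a p IHp; rewrite map_AddPoly /= IHp. Qed.

Lemma map_Rediv_rec_loop q sq cq c qq r n k k' :
  (forall c qq r, mf (k (c, qq, r)) = k' (c, mp qq, mp r)) ->
  mf (Rediv_rec_loop q sq cq c qq r n k) =
  Rediv_rec_loop (mp q) sq (mt cq) c (mp qq) (mp r) n k'.
Proof.
move=> kk'; elim: n c qq r => [|n IHn] c qq r /=; rewrite /bind_def map_Size;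
  congr (Size _ _); apply/funext => m; case: ifP => // _;
  apply: map_LeadCoef => l.
- by rewrite kk' !(map_AddPoly, map_MulPoly, map_OppPoly, map_AmulXn).
- by rewrite IHn !(map_AddPoly, map_MulPoly, map_OppPoly, map_AmulXn).
Qed.

Lemma map_Rediv p q k k' :
  (forall c qq r, mf (k (c, qq, r)) = k' (c, mp qq, mp r)) ->
  mf (Rediv p q k) = Rediv (mp p) (mp q) k'.
Proof.
move=> kk'; rewrite /Rediv /bind_def map_Isnull; congr (Isnull _ _).
apply/funext => -[]; first by rewrite kk' /= rmorph0.
rewrite map_Size; congr (Size _ _); apply/funext => m.
rewrite map_Size; congr (Size _ _); apply/funext => n.
apply: map_LeadCoef => l; rewrite (map_Rediv_rec_loop _ _ _ _ _ _ _ kk') /=.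
by rewrite rmorph0.
Qed.

Lemma map_Rgcd_loop n p q k k' : (forall r, mf (k r) = k' (mp r)) ->
  mf (Rgcd_loop n p q k) = Rgcd_loop n (mp p) (mp q) k'.
Proof.
move=> kk'; elim: n p q => [|n IHn] p q /=; rewrite /bind_def /Rmod;
  apply: map_Rediv => _ _ r /=; rewrite map_Isnull; congr (Isnull _ _);
  apply/funext => -[]; rewrite ?kk' ?IHn//.
Qed.

Lemma map_Rgcd p q k k' : (forall r, mf (k r) = k' (mp r)) ->
  mf (Rgcd p q k) = Rgcd (mp p) (mp q) k'.
Proof.
move=> kk'; rewrite /Rgcd /LtSize /bind_def map_Size; congr (Size _ _).
apply/funext => m; rewrite map_Size; congr (Size _ _); apply/funext => n.
case: ifP => _; rewrite map_Isnull; congr (Isnull _ _); apply/funext => -[];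
  rewrite ?kk' ?map_Size//; congr (Size _ _); apply/funext => j;
  exact: map_Rgcd_loop.
Qed.

Lemma map_BigRgcd ps k k' : (forall r, mf (k r) = k' (mp r)) ->
  mf (BigRgcd ps k) = BigRgcd (map mp ps) k'.
Proof.
elim: ps k k' => [|p ps IHps] k k' kk' /=; first by rewrite kk' /= rmorph0.
by apply: IHps => r; exact: map_Rgcd.
Qed.

Lemma map_Changes s k : mf (Changes s k) = Changes (mp s) (fun n => mf (k n)).
Proof.
elim: s k => //= a s IHs k; rewrite /bind_def IHs; congr (Changes _ _).
apply/funext => n; rewrite /= (_ : mt (head _ s) = head (NatConst G 0) (mp s))//.
by case: s {IHs}.
Qed.

Lemma map_SeqPInfty ps k k' : (forall s, mf (k s) = k' (mp s)) ->
  mf (SeqPInfty ps k) = SeqPInfty (map mp ps) k'.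
Proof.
elim: ps k k' => [|p ps IHps] k k' kk' /=; first by rewrite kk'.
by apply: map_LeadCoef => l; apply: IHps => s; rewrite kk'.
Qed.

Lemma map_SeqMInfty ps k k' : (forall s, mf (k s) = k' (mp s)) ->
  mf (SeqMInfty ps k) = SeqMInfty (map mp ps) k'.
Proof.
elim: ps k k' => [|p ps IHps] k k' kk' /=; first by rewrite kk'.
apply: map_LeadCoef => l; rewrite /bind_def map_Size; congr (Size _ _).
by apply/funext => n; apply: IHps => s; rewrite kk' /= rmorphN1.
Qed.

Lemma map_ChangesPoly ps k :
  mf (ChangesPoly ps k) = ChangesPoly (map mp ps) (fun n => mf (k n)).
Proof.
apply: map_SeqMInfty => s; apply: map_SeqPInfty => s'.
rewrite /bind_def map_Changes; congr (Changes _ _); apply/funext => n.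
by rewrite map_Changes.
Qed.

Lemma map_NextMod p q k k' : (forall s, mf (k s) = k' (mp s)) ->
  mf (NextMod p q k) = NextMod (mp p) (mp q) k'.
Proof.
move=> kk'; apply: map_LeadCoef => l; apply: map_Rediv => c qq r /=.
by apply: map_Rediv => c' qq' r' /=; rewrite kk' map_ScalPoly.
Qed.

Lemma map_ModsAux p q n k k' : (forall s, mf (k s) = k' (map mp s)) ->
  mf (ModsAux p q n k) = ModsAux (mp p) (mp q) n k'.
Proof.
elim: n p q k k' => [|n IHn] p q k k' kk' /=; first by rewrite kk'.
rewrite /bind_def map_Isnull; congr (Isnull _ _); apply/funext => -[].
  by rewrite kk'.
by apply: map_NextMod => r; apply: IHn => s; rewrite kk'.
Qed.

Lemma map_Mods p q k k' : (forall s, mf (k s) = k' (map mp s)) ->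
  mf (Mods p q k) = Mods (mp p) (mp q) k'.
Proof.
move=> kk'; rewrite /Mods /bind_def map_Size; congr (Size _ _); apply/funext => m.
by rewrite map_Size; congr (Size _ _); apply/funext => n; exact: map_ModsAux.
Qed.

Lemma map_PolyComb sq sc : mp (PolyComb sq sc) = PolyComb (map mp sq) sc.
Proof.
rewrite /PolyComb size_map; elim: (iota _ _) => //= i s IHs.
rewrite map_MulPoly map_ExpPoly; congr (MulPoly (ExpPoly _ _) _); last exact: IHs.
by have [lt|ge] := ltnP i (size sq); [rewrite (nth_map [::])|rewrite !nth_default ?size_map].
Qed.

Lemma map_Pcq sq i : mp (Pcq sq i) = Pcq (map mp sq) i.
Proof.
rewrite /Pcq size_map; move: (qe_rcf_th.sg_tab _) => s.
have [lt|ge] := ltnP i (size s); last by rewrite !nth_default ?size_map.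
by rewrite !(nth_map [::]) // map_PolyComb.
Qed.

Lemma map_TaqsR p sq i k k' : (forall c, mf (k c) = k' (mt c)) ->
  mf (TaqsR p sq i k) = TaqsR (mp p) (map mp sq) i k'.
Proof.
move=> kk'; rewrite /TaqsR /TaqR /bind_def -map_Pcq -map_Deriv -map_MulPoly.
apply: map_Mods => s; rewrite map_ChangesPoly; congr (ChangesPoly _ _).
by apply/funext => n; rewrite kk' /= rmorph_int.
Qed.

Lemma map_BoundingPoly sq : mp (BoundingPoly sq) = BoundingPoly (map mp sq).
Proof.
rewrite /BoundingPoly map_Deriv; congr Deriv.
by elim: sq => //= p sq IHsq; rewrite map_MulPoly IHsq.
Qed.

(** The only place where the ground field matters: the coefficients are entries of
    the inverse of an integer matrix, and inverses commute with field morphisms. *)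
Lemma map_coefs n i : h (qe_rcf_th.coefs F n i) = qe_rcf_th.coefs G n i.
Proof.
rewrite /qe_rcf_th.coefs; have [lt|ge] := ltnP i (size (enum 'I_(3 ^ n))); last first.
  rewrite !nth_default ?size_map -?enumT//; exact: rmorph0.
have i0 : 'I_(3 ^ n) by move: lt; rewrite -?enumT -cardE card_ord => /Ordinal.
rewrite !(nth_map i0) -?enumT//= !castmxE /= !cast_ord_id.
have -> : map_mx intr (qe_rcf_th.ctmat n) = map_mx h (map_mx intr (qe_rcf_th.ctmat n)).
  by apply/matrixP => a b; rewrite !mxE rmorph_int.
by rewrite -map_invmx mxE.
Qed.

Lemma map_Coefs n i : mt (Coefs F n i) = Coefs G n i.
Proof.
rewrite /Coefs /=; congr Const; case: n => [|[|n]].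
- by rewrite rmorph_nat.
- by case: i => [|[|[|i]]] /=; rewrite ?(fmorphV, rmorph_nat, rmorph0)// !nth_nil rmorph0.
- exact: map_coefs.
Qed.

Lemma map_CcountWeak p sq k k' : (forall c, mf (k c) = k' (mt c)) ->
  mf (CcountWeak p sq k) = CcountWeak (mp p) (map mp sq) k'.
Proof.
move=> kk'; rewrite /CcountWeak size_map.
change (NatConst G 0) with (mt (NatConst F 0)).
elim: (_ ^ _)%N (NatConst F 0) => [|n IHn] s /=; first exact: kk'.
by apply: map_TaqsR => c; rewrite IHn -map_Coefs.
Qed.

Lemma map_CcountGt0 sp sq : mf (CcountGt0 sp sq) =
  CcountGt0 (map mp sp) (map mp sq).
Proof.
apply: map_BigRgcd => p; rewrite /bind_def map_Isnull; congr (Isnull _ _).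
apply/funext => -[] /=; last by apply: map_CcountWeak.
rewrite -map_BoundingPoly; apply: map_CcountWeak => c /=.
congr (Or _ (Or _ _)).
  by elim: sq => //= q sq ->; congr And; apply: map_LeadCoef.
elim: sq => //= q sq ->; congr And; rewrite map_Size; congr (Size _ _).
by apply/funext => n; apply: map_LeadCoef.
Qed.

Lemma map_abstrX i t : mp (abstrX i t) = abstrX i (mt t).
Proof.
elim: t => //=.
- by move=> n; case: ifP.
- by move=> a <- b <-; rewrite map_AddPoly.
- by move=> a <-; rewrite map_OppPoly.
- by move=> a <- n; rewrite map_NatMulPoly.
- by move=> a <- b <-; rewrite map_MulPoly.
- by move=> a <- n; rewrite map_ExpPoly.
Qed.

End FormulaMap.

(** * Transfer of sign conditions between real closed fields *)

Section SignTransfer.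
Import qe_rcf.

(** Terms are evaluated in arbitrary commutative rings, and not only in ordered
    fields, since the generic points used below live in polynomial rings. *)
Fixpoint geval (A : comNzRingType) (h : rat -> A) (e : seq A) (t : term rat) : A :=
  match t with
  | Var i => e`_i
  | Const c => h c
  | NatConst n => n%:R
  | Add a b => geval h e a + geval h e b
  | Opp a => - geval h e a
  | NatMul a n => geval h e a *+ n
  | Mul a b => geval h e a * geval h e b
  | Exp a n => geval h e a ^+ n
  end.

Lemma geval_morph (A B : comNzRingType) (phi : {rmorphism A -> B}) h h' e t :
  (forall q, phi (h q) = h' q) -> phi (geval h e t) = geval h' (map phi e) t.
Proof.
move=> hh'; elim: t => //=.
- move=> i; have [lt|ge] := ltnP i (size e); first by rewrite (nth_map 0).
  by rewrite !nth_default ?size_map// rmorph0.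
- by move=> n; rewrite rmorph_nat.
- by move=> a <- b <-; rewrite rmorphD.
- by move=> a <-; rewrite rmorphN.
- by move=> a <- n; rewrite rmorphMn.
- by move=> a <- b <-; rewrite rmorphM.
- by move=> a <- n; rewrite rmorphXn.
Qed.

Lemma eval_map_term (M : realFieldType) (e : seq M) t :
  eval e (map_term (@ratr M) t) = geval ratr e t.
Proof.
elim: t => //=.
- by move=> a -> b ->.
- by move=> a ->.
- by move=> a ->.
- by move=> a -> b ->.
- by move=> a ->.
Qed.

(** The truth of a quantifier-free formula depends only on the signs of these
    terms. *)
Fixpoint atoms (f : formula rat) : seq (term rat) :=
  match f with
  | Bool b => [::]
  | Equal a b => [:: Add a (Opp b)]
  | Lt a b => [:: Add a (Opp b)]
  | Le a b => [:: Add a (Opp b)]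
  | And f1 f2 => atoms f1 ++ atoms f2
  | Or f1 f2 => atoms f1 ++ atoms f2
  | Implies f1 f2 => atoms f1 ++ atoms f2
  | Not f1 => atoms f1
  end.

Section TwoFields.
Variables M N : rcfType.
Implicit Types (x : seq M) (y : seq N).

Definition same_sign x y t := sgz (geval ratr x t) == sgz (geval ratr y t).

Lemma qf_eval_atoms x y f : all (same_sign x y) (atoms f) ->
  qf_eval x (map_formula (@ratr M) f) = qf_eval y (map_formula (@ratr N) f).
Proof.
have sub0 (K : rcfType) (u v : K) : ((u == v) = (sgz (u - v) == 0)) *
    ((u < v) = (sgz (u - v) == - 1)) * ((u <= v) = (sgz (u - v) != 1)).
  by rewrite !sgz_cp0 subr_eq0 subr_lt0 subr_gt0 leNgt.
elim: f => //=.
- move=> a b; rewrite /same_sign /= andbT => /eqP h.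
  by rewrite !eval_map_term !sub0 h.
- move=> a b; rewrite /same_sign /= andbT => /eqP h.
  by rewrite !eval_map_term !sub0 h.
- move=> a b; rewrite /same_sign /= andbT => /eqP h.
  by rewrite !eval_map_term !sub0 h.
- by move=> f IHf g IHg; rewrite all_cat => /andP[/IHf -> /IHg ->].
- by move=> f IHf g IHg; rewrite all_cat => /andP[/IHf -> /IHg ->].
- by move=> f IHf g IHg; rewrite all_cat => /andP[/IHf -> /IHg ->].
- by move=> f IHf /IHf ->.
Qed.

End TwoFields.

Lemma set_nth_size (T : Type) (x0 : T) s x : set_nth x0 s (size s) x = rcons s x.
Proof. by elim: s => //= y s ->. Qed.

(** Projection along the last of n+1 variables of the set where the terms of sp
    vanish and those of sq are positive. *)
Definition proj_formula n (sp sq : seq (term rat)) : formula rat :=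
  CcountGt0 (map (abstrX n) sp) (map (abstrX n) sq).

Lemma proj_formulaP (M : rcfType) (x : seq M) sp sq :
  reflect (exists u, all (fun t => geval ratr (rcons x u) t == 0) sp &&
                     all (fun t => 0 < geval ratr (rcons x u) t) sq)
    (qf_eval x (map_formula (@ratr M) (proj_formula (size x) sp sq))).
Proof.
rewrite map_CcountGt0 eval_CcountGt0.
have E t u : (eval_poly x (map (map_term (@ratr M)) (abstrX (size x) t))).[u] =
    geval ratr (rcons x u) t.
  by rewrite map_abstrX abstrXP set_nth_size eval_map_term.
apply: (iffP (qe_rcf_th.ccount_gt0P _ _)) => -[u h]; exists u; move: h;
  rewrite !big_all !all_map => /andP[h0 hp]; apply/andP; split;
  [move: h0|move: hp|move: h0|move: hp]; by apply: sub_all => t /=; rewrite E.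
Qed.

(** If e and e' satisfy the same sign conditions over the rationals, then any
    finite set of signs taken at an extension of e by a tuple y is also taken at an
    extension of e' by a tuple z. Induction on the length of y: the last coordinate
    is eliminated, and the signs to be preserved at the remaining coordinates are
    those of the atoms of the projected formula. *)
Theorem sign_transfer (M N : rcfType) (e : seq M) (e' : seq N) :
  size e = size e' -> (forall t, same_sign e e' t) ->
  forall (y : seq M) (G : seq (term rat)),
  exists2 z : seq N, size z = size y & all (same_sign (e ++ y) (e' ++ z)) G.
Proof.
move=> see' ee'; elim/last_ind => [|y u IHy] G.
  by exists [::]; rewrite ?cats0//; elim: G => //= t G ->; rewrite ee'.
pose v t := geval ratr (rcons (e ++ y) u) t.
pose sp := [seq t <- G | v t == 0].
pose sq := [seq t <- G | 0 < v t] ++ [seq Opp t | t <- G & v t < 0].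
pose n := size (e ++ y).
have [z szz zG] := IHy (atoms (proj_formula n sp sq)).
have n' : n = size (e' ++ z) by rewrite /n !size_cat see' szz.
have : qf_eval (e ++ y) (map_formula (@ratr M) (proj_formula n sp sq)).
  apply/proj_formulaP; exists u; rewrite filter_all all_cat filter_all /= all_map.
  elim: G {sp sq zG} => //= t G IHG; case: ifP => //= vt.
  by rewrite oppr_gt0 vt.
rewrite (qf_eval_atoms zG) n' => /proj_formulaP[w /andP[h0]].
rewrite all_cat => /andP[hp hn]; exists (rcons z w); first by rewrite !size_rcons szz.
rewrite -!rcons_cat; move: h0 hp hn; rewrite /sp; elim: G {sp sq zG} => //= t G IHG.
rewrite /same_sign -/(v t); case: (sgzP (v t)) => vt /=; rewrite ?eqxx /=.
- by move=> /andP[/eqP -> hG] hp hn; rewrite sgz0 eqxx /=; exact: IHG.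
- by move=> hG /andP[ht hp] hn; rewrite gtr0_sgz// eqxx /=; exact: IHG.
- by move=> hG hp /andP[]; rewrite /= oppr_gt0 => ht hn; rewrite ltr0_sgz// eqxx /=; exact: IHG.
Qed.

End SignTransfer.

(** * Real points of prime cones *)

(** The real closed field attached to a prime cone is built for countable rings;
    a polynomial is encoded by the list of its coefficients. *)
Section CountableMpoly.
Variable n : nat.

Definition mpoly_pickle (p : mpoly n rat) : nat :=
  pickle [seq (m, mcoeff m p) | m <- msupp p].
Definition mpoly_unpickle (k : nat) : option (mpoly n rat) :=
  omap (fun s : seq (multinom n * rat) => \sum_(x <- s) x.2 *: mpolyX rat x.1)
    (unpickle k).

Lemma mpoly_pickleK : pcancel mpoly_pickle mpoly_unpickle.
Proof.
by move=> p; rewrite /mpoly_unpickle pickleK /= big_map -mpolyE.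
Qed.

HB.instance Definition _ := Choice_isCountable.Build (mpoly n rat) mpoly_pickleK.

End CountableMpoly.

Lemma preimage_prime_cone (A B : comNzRingType) (phi : {rmorphism A -> B}) (P : set B) :
  prime_cone P -> prime_cone [set a | P (phi a)]%classic.
Proof.
move=> [[sq add mul] P1 tot pr]; split=> /=.
- split=> [x|x y|x y]; rewrite /= ?(rmorphXn, rmorphD, rmorphM); [exact: sq|exact: add|exact: mul].
- by rewrite rmorphN1.
- by move=> x; rewrite rmorphN.
- by move=> x y; rewrite !rmorphN rmorphM; exact: pr.
Qed.

Section PointOfPrimeCone.
Variables (R : rcfType) (d : nat).
Implicit Types (P : set (mpoly d R)) (f : mpoly d R).

Lemma prime_cone_const P (a : R) : prime_cone P -> 0 <= a -> P (mpolyC d a).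
Proof.
move=> pP a0; rewrite -(sqr_sqrtr a0) rmorphXn; exact: prime_cone_sqr.
Qed.

(** In a prime cone of a polynomial algebra over a real closed field the constants
    are ordered as in the field, since nonnegative constants are squares. *)
Lemma prime_cone_constE P (a : R) : prime_cone P -> P (mpolyC d a) <-> 0 <= a.
Proof.
move=> pP; split=> [Pa|]; last exact: prime_cone_const.
rewrite leNgt; apply/negP => a0; apply: (prime_coneN1 pP).
have -> : - 1 = mpolyC d a * mpolyC d (- a)^-1.
  by rewrite -mpolyCM invrN mulrN mulfV ?lt_eqF// mpolyCN mpolyC1.
by apply: prime_coneM => //; apply: prime_cone_const => //; rewrite invr_ge0 oppr_ge0 ltW.
Qed.

Let rep (E : seq (mpoly d R)) f := exists t, f = geval (@mpolyC d R \o ratr) E t.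

Lemma geval_surj E f : (forall i, mpolyX R (mnm1 i) \in E) ->
  {in msupp f, forall m, mpolyC d (mcoeff m f) \in E} -> rep E f.
Proof.
move=> EX Ec.
have rE g : g \in E -> rep E g.
  by move=> gE; exists (qe_rcf.Var _ (index g E)); rewrite /= nth_index.
have rD g h : rep E g -> rep E h -> rep E (g + h).
  by move=> [s ->] [t ->]; exists (qe_rcf.Add s t).
have rM g h : rep E g -> rep E h -> rep E (g * h).
  by move=> [s ->] [t ->]; exists (qe_rcf.Mul s t).
have r0 : rep E 0 by exists (qe_rcf.NatConst _ 0).
have r1 : rep E 1 by exists (qe_rcf.NatConst _ 1).
rewrite [f]mpolyE big_seq; apply: (big_ind (rep E)) => [||m mf]; [exact: r0|exact: rD|].
rewrite -mul_mpolyC; apply: (rM); first exact/rE/Ec.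
rewrite mpolyXE_id; apply: (big_ind (rep E)) => [||i _]; [exact: r1|exact: rM|].
by elim: (m i) => [|j IHj]; rewrite ?expr0// exprS; apply: (rM) => //; exact: rE.
Qed.

(** An Artin-Lang theorem. The polynomials fs involve finitely many coefficients
    cs, so they come from polynomials with rational coefficients in variables that
    stand for cs and for the coordinates. The prime cone pulls back to this
    countable ring, which embeds accordingly in a real closed field M. In M the
    images of the first variables satisfy the same rational sign conditions as cs
    in R, and the images of the others are a point where fs is nonnegative; the
    sign conditions transfer to a point over R. *)
Theorem prime_cone_point P (fs : seq (mpoly d R)) : prime_cone P ->
  {in fs, forall f, P f} -> exists x : 'I_d -> R, {in fs, forall f, 0 <= meval x f}.
Proof.
move=> pP Pfs.
pose cs := flatten [seq [seq mcoeff m f | m <- msupp f] | f <- fs].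
pose Xs := [seq mpolyX R (mnm1 i) | i <- enum 'I_d].
pose E := map (@mpolyC d R) cs ++ Xs.
have rep_fs f : f \in fs -> exists t, f = geval (@mpolyC d R \o ratr) E t.
  move=> ffs; apply: geval_surj => [i|m mf]; rewrite mem_cat; apply/orP.
    by right; apply: map_f; rewrite mem_enum.
  left; apply: map_f; apply/flattenP; exists [seq mcoeff m f | m <- msupp f].
    exact: (map_f (fun f => [seq mcoeff m f | m <- msupp f])).
  exact: (map_f (fun m => mcoeff m f)).
pose n := size E; pose A := mpoly n rat.
pose theta : {rmorphism A -> mpoly d R} :=
  mmap (@mpolyC d R \o ratr) (fun i : 'I_n => E`_i).
have pP0 : prime_cone [set a : A | P (theta a)]%classic by exact: preimage_prime_cone.
have [M [psi psiP]] := real_closed_embedding (PrimeConeOf pP0).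
pose Z : seq A := [seq mpolyX rat (mnm1 i) | i <- enum 'I_n].
have thetaZ : map theta Z = E.
  apply: (@eq_from_nth _ 0); rewrite /Z 2!size_map size_enum_ord// => i lt.
  rewrite -map_comp (nth_map (Ordinal lt)) ?size_enum_ord//= mmapX mmap1U.
  by rewrite nth_enum_ord.
have thetaC q : theta (mpolyC n q) = (@mpolyC d R \o ratr) q by exact: mmapC.
have psiC q : psi (mpolyC n q) = ratr q.
  have e : psi \o @mpolyC n rat =1 ratr.
    exact: (fmorph_eq_rat (psi \o @mpolyC n rat : {rmorphism rat -> M})).
  exact: e.
pose m := size cs; pose Zm := take m Z.
have thetaZm : map theta Zm = map (@mpolyC d R) cs.
  by rewrite /Zm map_take thetaZ /E take_size_cat// size_map.
have szZm : size (map psi Zm) = size cs.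
  by rewrite size_map -(size_map theta) thetaZm size_map.
(* nonnegativity of a term and of its opposite determine its sign *)
have base t : same_sign (map psi Zm) cs t.
  have main s : (0 <= geval ratr (map psi Zm) s) = (0 <= geval ratr cs s).
    rewrite -(geval_morph _ _ psiC); apply/idP/idP.
      move=> /psiP /=; rewrite (geval_morph _ _ thetaC) thetaZm.
      rewrite -(@geval_morph _ _ (@mpolyC d R) ratr _ cs s (fun=> erefl)).
      by move=> /(prime_cone_constE _ pP).
    move=> h; apply/psiP; rewrite /= (geval_morph _ _ thetaC) thetaZm.
    rewrite -(@geval_morph _ _ (@mpolyC d R) ratr _ cs s (fun=> erefl)).
    exact/(prime_cone_constE _ pP).
  rewrite /same_sign; have := main t; have := main (qe_rcf.Opp t).
  rewrite /= !oppr_ge0.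
  by case: (sgzP (geval ratr (map psi Zm) t)) => h;
    case: (sgzP (geval ratr cs t)) => h' //=; rewrite ?h ?h' ?lexx ?(ltW h) ?(ltW h') //
      ?(lt_geF h) ?(lt_geF h').
have /choice[tm tmE] : forall f, exists t, f \in fs -> f = geval (@mpolyC d R \o ratr) E t.
  move=> f; have [/rep_fs[t ->]|] := boolP (f \in fs); first by exists t.
  by exists (qe_rcf.NatConst _ 0).
have [z szz zG] := sign_transfer szZm base (map psi (drop m Z)) [seq tm f | f <- fs].
pose x (i : 'I_d) := z`_i.
have Ez : map (meval x) E = cs ++ z.
  rewrite /E map_cat -map_comp (eq_map (mevalC x)) map_id; congr (_ ++ _).
  have zd : size z = d.
    rewrite szz size_map size_drop size_map size_enum_ord /n /E size_cat.
    by rewrite 2!size_map size_enum_ord addKn.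
  apply: (@eq_from_nth _ 0); rewrite 2!size_map size_enum_ord ?zd// => i lt.
  by rewrite -map_comp (nth_map (Ordinal lt)) ?size_enum_ord//= mevalXU /x nth_enum_ord.
exists x => f ffs; rewrite (tmE f ffs).
rewrite (@geval_morph _ _ (meval x) _ ratr); last by move=> q; rewrite /= mevalC.
move: zG; rewrite -map_cat cat_take_drop all_map => /allP/(_ f ffs) /=.
rewrite Ez /same_sign => /eqP e.
rewrite -sgz_ge0 -e sgz_ge0 -(geval_morph _ _ psiC); apply/psiP.
by rewrite /= (geval_morph _ _ thetaC) thetaZ -tmE//; exact: Pfs.
Qed.

End PointOfPrimeCone.

(** * Archimedean preorderings and positivity on compact sets *)

Section PreorderingCone.
Variables (R : realType) (d k : nat).
Local Notation A := (mpoly d R).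
Variable f : 'I_k -> A.

Lemma sosD (p q : A) : sos p -> sos q -> sos (p + q).
Proof. by move=> [s ->] [t ->]; exists (s ++ t); rewrite big_cat. Qed.

Lemma sosM (p q : A) : sos p -> sos q -> sos (p * q).
Proof.
move=> [s ->] [t ->]; exists [seq x * y | x <- s, y <- t].
rewrite big_allpairs_dep mulr_suml; apply: eq_bigr => x _; rewrite mulr_sumr.
by apply: eq_bigr => y _; rewrite exprMn.
Qed.

Lemma sos_sqr (p : A) : sos (p ^+ 2).
Proof. by exists [:: p]; rewrite big_seq1. Qed.

Lemma sos0 : sos (0 : A).
Proof. by exists [::]; rewrite big_nil. Qed.

Let mon (e : {ffun 'I_k -> bool}) : A := \prod_(i < k) f i ^+ (e i : nat).

Lemma preorderingD p q : preordering f p -> preordering f q -> preordering f (p + q).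
Proof.
move=> [s sP ->] [t tP ->]; exists (fun e => s e + t e) => [e|].
  exact: sosD.
by rewrite -big_split; apply: eq_bigr => e _; rewrite mulrDr.
Qed.

Lemma preordering_mon e s : sos s -> preordering f (mon e * s).
Proof.
move=> ss; exists (fun e' => if e' == e then s else 0) => [e'|].
  by case: ifP => // _; exact: sos0.
rewrite (bigD1 e)//= eqxx [X in _ + X]big1 ?addr0// => e' /negPf ->.
by rewrite mulr0.
Qed.

(** The only nontrivial closure is under products: the product of the monomials
    of exponents e and e' is the monomial of exponent e (+) e' times the square of
    the monomial of exponent e && e'. *)
Lemma preordering_precone : precone (preordering f).
Proof.
split; last 2 first.
- exact: preorderingD.
- move=> _ _ [s sP ->] [t tP ->]; rewrite mulr_suml.
  have PO0 : preordering f 0.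
    have := preordering_mon [ffun=> false] sos0; rewrite mulr0; exact.
  apply: (big_ind (preordering f)) => [//||e _]; first exact: preorderingD.
  rewrite mulr_sumr.
  apply: (big_ind (preordering f)) => [//||e' _]; first exact: preorderingD.
  have -> : \prod_(i < k) f i ^+ e i * s e * (\prod_(i < k) f i ^+ e' i * t e') =
     mon [ffun i => e i (+) e' i] * (mon [ffun i => e i && e' i] ^+ 2 * (s e * t e')).
    rewrite mulrACA [RHS]mulrA; congr (_ * _).
    rewrite /mon /= expr2 -!big_split; apply: eq_bigr => i _ /=.
    by rewrite !ffunE; case: (e i); case: (e' i); rewrite /= ?expr0 ?expr1 ?mulr1 ?mul1r.
  by apply: preordering_mon; apply: sosM; [exact: sos_sqr|exact: sosM].
- move=> p; have := preordering_mon [ffun=> false] (sos_sqr p).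
  by rewrite /mon big1 ?mul1r// => i _; rewrite ffunE.
Qed.

Lemma preordering_gen i : preordering f (f i).
Proof.
have := preordering_mon [ffun j => j == i] (sos_sqr 1).
rewrite expr1n mulr1 /mon (bigD1 i)//= ffunE eqxx big1 ?mulr1//.
by move=> j /negPf ji; rewrite ffunE ji.
Qed.

End PreorderingCone.

Section Archimedean.
Variables (R : realType) (d : nat).
Local Notation A := (mpoly d R).
Local Notation "c %:MP" := (mpolyC d c) (at level 1, format "c %:MP").
Implicit Types (T : set A) (p q : A).

Definition archimedean_cone T := forall p, exists c : R, T (c%:MP - p).

Definition sqr_norm : A := \sum_(i < d) (mpolyX R (mnm1 i)) ^+ 2.

Variable T : set A.
Hypothesis pT : precone T.

Lemma preconeD p q : T p -> T q -> T (p + q).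
Proof. by case: pT => _ + _; apply. Qed.

Lemma preconeM p q : T p -> T q -> T (p * q).
Proof. by case: pT => _ _; apply. Qed.

Lemma precone_sqr p : T (p ^+ 2).
Proof. by case: pT. Qed.

Lemma precone_const (a : R) : 0 <= a -> T a%:MP.
Proof. by move=> a0; rewrite -(sqr_sqrtr a0) rmorphXn; exact: precone_sqr. Qed.

Lemma precone_sum (I : Type) (r : seq I) (P : pred I) (F : I -> A) :
  (forall i, P i -> T (F i)) -> T (\sum_(i <- r | P i) F i).
Proof. by move=> h; apply: big_ind => //; [exact: precone0|exact: preconeD]. Qed.

Lemma precone_half p : T (p + p) -> T p.
Proof.
move=> Tp; have -> : p = (2^-1)%:MP * (p + p).
  rewrite -mulr2n -[p *+ 2]mulr_natl mulrA -mpolyC_nat -mpolyCM mulVf ?pnatr_eq0//.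
  by rewrite mpolyC1 mul1r.
by apply: preconeM => //; apply: precone_const; rewrite invr_ge0.
Qed.

(** The polynomials p such that c - p and c + p lie in T for some constant c form a
    subalgebra, by the identities expressing 2 (c c' -+ p q) through the products of
    c +- p and c' +- q. It contains the variables because 2 x is bounded by x^2 + 1. *)
Lemma archimedean_ball (N : R) : T (N%:MP - sqr_norm) -> archimedean_cone T.
Proof.
move=> TN; pose B p := exists c : R, T (c%:MP - p) /\ T (c%:MP + p).
have Bc a : B a%:MP.
  exists `|a|; rewrite -mpolyCB -mpolyCD.
  by split; apply: precone_const; rewrite ?subr_ge0 ?ler_norm// -lerBlDl sub0r lerNl -normrN ler_norm.
have BD p q : B p -> B q -> B (p + q).
  move=> [c [c1 c2]] [c' [c'1 c'2]]; exists (c + c'); rewrite mpolyCD.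
  have -> : c%:MP + c'%:MP - (p + q) = (c%:MP - p) + (c'%:MP - q) by ring.
  have -> : c%:MP + c'%:MP + (p + q) = (c%:MP + p) + (c'%:MP + q) by ring.
  by split; apply: preconeD.
have BM p q : B p -> B q -> B (p * q).
  move=> [c [c1 c2]] [c' [c'1 c'2]]; exists (c * c'); rewrite mpolyCM.
  split; apply: precone_half.
    have -> : c%:MP * c'%:MP - p * q + (c%:MP * c'%:MP - p * q) =
      (c%:MP - p) * (c'%:MP + q) + (c%:MP + p) * (c'%:MP - q) by ring.
    by apply: preconeD; apply: preconeM.
  have -> : c%:MP * c'%:MP + p * q + (c%:MP * c'%:MP + p * q) =
    (c%:MP - p) * (c'%:MP - q) + (c%:MP + p) * (c'%:MP + q) by ring.
  by apply: preconeD; apply: preconeM.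
have BX i : B (mpolyX R (mnm1 i)).
  set X := mpolyX R _; have TX : T (N%:MP - X ^+ 2).
    have -> : N%:MP - X ^+ 2 = (N%:MP - sqr_norm) +
        \sum_(j < d | j != i) (mpolyX R (mnm1 j)) ^+ 2.
      by rewrite /sqr_norm (bigD1 i)//= -/X; ring.
    by apply: preconeD => //; apply: precone_sum => j _; exact: precone_sqr.
  exists ((N + 1) / 2); set c := _%:MP.
  have cc : c + c = N%:MP + 1.
    by rewrite /c -mpolyCD -splitr mpolyCD mpolyC1.
  split; apply: precone_half.
    have -> : c - X + (c - X) = (N%:MP - X ^+ 2) + (X - 1) ^+ 2.
      have -> : c - X + (c - X) = c + c - (X + X) by ring.
      by rewrite cc; ring.
    by apply: preconeD => //; exact: precone_sqr.
  have -> : c + X + (c + X) = (N%:MP - X ^+ 2) + (X + 1) ^+ 2.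
    have -> : c + X + (c + X) = c + c + (X + X) by ring.
    by rewrite cc; ring.
  by apply: preconeD => //; exact: precone_sqr.
have Ball p : B p.
  rewrite [p]mpolyE; apply: (big_ind B) => [||m _]; [|exact: BD|].
    by rewrite -mpolyC0.
  rewrite -mul_mpolyC; apply: (BM) => //.
  rewrite mpolyXE_id; apply: (big_ind B) => [||i _]; [|exact: BM|].
    by rewrite -mpolyC1.
  elim: (m i) => [|j IHj]; first by rewrite expr0 -mpolyC1.
  by rewrite exprS; exact: (BM).
by move=> p; have [c [c1 _]] := Ball p; exists c.
Qed.

End Archimedean.

Section Woermann.
Variables (R : realType) (d : nat).
Local Notation A := (mpoly d R).
Local Notation "c %:MP" := (mpolyC d c) (at level 1, format "c %:MP").
Implicit Types (p q : A).
Variable T : set A.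
Hypothesis pT : precone T.

(** The hypothesis gives g, h in T with h q = 1 + g for q = N - |x|^2. Adjoining q
    makes T archimedean, so m - g = a + q b for some constant m. Multiplying by
    1 + g eliminates q, since (1 + g) q = h q^2 is in T, and a square of g - m / 2
    then bounds g by a constant in T itself; finally |x|^2 is bounded by
    N + N g <= N + N m'. *)
Lemma woermann (N : R) : 0 <= N ->
  adjoin_cone T (- (N%:MP - sqr_norm R d)) (- 1) -> archimedean_cone T.
Proof.
move=> N0; set q := N%:MP - _ => -[g [h [Tg Th e]]].
have hq : h * q = 1 + g.
  have -> : h * q = g - (g + - q * h) by ring.
  by rewrite -e; ring.
have T1q : T ((1 + g) * q).
  rewrite -hq (_ : h * q * q = h * q ^+ 2); last by ring.
  by apply: preconeM => //; exact: precone_sqr.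
have T1g : T (1 + g) by apply: preconeD => //; exact: precone1.
have [p0 _ qA] := adjoin_coneP q pT.
have [m [a [b [Ta Tb mg]]]] := archimedean_ball p0 qA g.
pose u : A := (m / 2)%:MP.
have uu : m%:MP = u + u.
  by rewrite /u -mpolyCD -splitr.
pose m' := m + (m / 2) ^+ 2.
have Tm' : T (m'%:MP - g).
  have -> : m'%:MP - g = (1 + g) * a + (1 + g) * q * b + (g - u) ^+ 2.
    have -> : (1 + g) * a + (1 + g) * q * b = (1 + g) * (a + q * b) by ring.
    by rewrite -mg uu /m' mpolyCD rmorphXn /= -/u uu; ring.
  apply: (preconeD pT); last exact: precone_sqr.
  by apply: (preconeD pT); apply: (preconeM pT).
apply: (@archimedean_ball _ _ _ pT (N + N * m')).
have -> : (N + N * m')%:MP - sqr_norm R d =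
    (1 + g) * q + g * sqr_norm R d + N%:MP * (m'%:MP - g).
  by rewrite mpolyCD mpolyCM /q; ring.
apply: (preconeD pT); first apply: (preconeD pT) => //.
  by apply: (preconeM pT) => //; apply: (precone_sum pT) => i _; exact: precone_sqr.
by apply: (preconeM pT) => //; exact: precone_const.
Qed.

(** From p t = 1 + s with s, t in T: if p + r is in T with r >= 0, so is
    p + r - 1 / c, where the constant c dominates t and t^2 p. Iterating finitely
    often makes r negative. *)
Lemma archimedean_positive (p : A) : archimedean_cone T ->
  adjoin_cone T (- p) (- 1) -> T p.
Proof.
move=> aT [s [t [Ts Tt e]]].
have pt : p * t = 1 + s.
  have -> : p * t = s - (s + - p * t) by ring.
  by rewrite -e; ring.
have [c0 Tc0] := aT (- p); have [c1 Tc1] := aT t; have [c2 Tc2] := aT (t ^+ 2 * p).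
pose c := Num.max 1 (Num.max c1 c2).
have c_gt0 : 0 < c by rewrite lt_max ltr01.
have mono a b q : a <= b -> T (a%:MP - q) -> T (b%:MP - q).
  move=> ab Ta; have -> : b%:MP - q = (b - a)%:MP + (a%:MP - q) by rewrite mpolyCB; ring.
  by apply: (preconeD pT) => //; apply: precone_const => //; rewrite subr_ge0.
have T2 : T (c%:MP - t).
  by apply: mono Tc1; rewrite /c !le_max lexx !orbT.
have T3 : T (c%:MP - t ^+ 2 * p).
  by apply: mono Tc2; rewrite /c !le_max lexx !orbT.
have step r : 0 <= r -> T (p + r%:MP) -> T (p + (r - c^-1)%:MP).
  move=> r0 Tr; have -> : p + (r - c^-1)%:MP =
      (c ^- 2)%:MP * (c%:MP ^+ 2 * (p + r%:MP) - c%:MP).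
    have E : (c ^- 2)%:MP * c%:MP ^+ 2 = 1.
      by rewrite -rmorphXn -mpolyCM mulVf ?mpolyC1// expf_neq0// gt_eqF.
    have E' : (c ^- 2)%:MP * c%:MP = (c^-1)%:MP.
      by rewrite -mpolyCM expr2 invfM -mulrA mulVf ?mulr1// gt_eqF.
    by rewrite mulrBr mulrA E E' mul1r mpolyCB; ring.
  apply: (preconeM pT); first by apply: precone_const => //; rewrite invr_ge0 exprn_ge0// ltW.
  have -> : c%:MP ^+ 2 * (p + r%:MP) - c%:MP =
     (c%:MP - t) ^+ 2 * (p + r%:MP) + (c%:MP + c%:MP) * (p * t - 1) +
     r%:MP * t * (c%:MP + (c%:MP - t)) + (c%:MP - t ^+ 2 * p) by ring.
  have Tc : T c%:MP by apply: precone_const => //; exact: ltW.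
  apply: (preconeD pT) => //; apply: (preconeD pT); first apply: (preconeD pT).
  - by apply: (preconeM pT) => //; exact: precone_sqr.
  - by rewrite pt (_ : 1 + s - 1 = s); [apply: (preconeM pT) => //; exact: (preconeD pT)|ring].
  - apply: (preconeM pT); last exact: (preconeD pT).
    by apply: (preconeM pT) => //; exact: precone_const.
have drop r : r <= 0 -> T (p + r%:MP) -> T p.
  move=> r0 Tr; have -> : p = (p + r%:MP) + (- r)%:MP by rewrite mpolyCN; ring.
  by apply: (preconeD pT) => //; apply: precone_const => //; rewrite oppr_ge0.
have iter n : T (p + (c0 - n%:R / c)%:MP) \/ T p.
  elim: n => [|n [IHn|]]; [left|..|by right].
    by rewrite mul0r subr0 addrC -[p]opprK.
  have [r0|/ltW r0] := leP 0 (c0 - n%:R / c); last by right; exact: drop IHn.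
  by left; have := step _ r0 IHn; rewrite -addrA -opprD -natr1 mulrDl mul1r.
have [|//] := iter (Num.bound (c0 * c)); apply: drop.
rewrite subr_le0 ler_pdivlMr//; have [c00|c00] := leP 0 (c0 * c).
  by apply: ltW; rewrite archi_boundP.
by rewrite (le_trans (ltW c00)).
Qed.

End Woermann.

Section Positivstellensatz.
Variables (R : realType) (d k : nat) (f : 'I_k -> mpoly d R).
Local Notation A := (mpoly d R).
Local Notation "c %:MP" := (mpolyC d c) (at level 1, format "c %:MP").

(** Otherwise a prime cone contains the f i and - p, hence some point of the set
    defined by f satisfies p <= 0. *)
Lemma weak_positivstellensatz (p : A) :
  (forall x, semialgebraic_set f x -> 0 < peval p x) ->
  adjoin_cone (preordering f) (- p) (- 1).
Proof.
move=> pK; apply/not_notP => T1.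
have [pA TA pAp] := adjoin_coneP (- p) (preordering_precone f).
have [P [AP pP]] := exists_prime_cone pA T1.
have [q|x xP] := @prime_cone_point R d P (- p :: [seq f i | i <- enum 'I_k]) pP.
  by rewrite inE => /predU1P[->|/mapP[i _ ->]]; apply: AP => //; exact/TA/preordering_gen.
pose y : 'rV[R]_d := \row_i x i.
have yx : y ord0 = x by apply/funext => i; rewrite mxE.
have Ky : semialgebraic_set f y.
  by move=> i; rewrite /peval yx xP// inE map_f ?orbT// mem_enum.
have := pK _ Ky; rewrite /peval yx ltNge -oppr_ge0 -mevalN.
by rewrite xP// inE eqxx.
Qed.

Hypothesis Kc : compact (semialgebraic_set f).

Lemma compact_sqr_norm : exists2 N : R, 0 <= N &
  forall x, semialgebraic_set f x -> 0 < peval (N%:MP - sqr_norm R d) x.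
Proof.
have [M [Mreal MK]] := compact_bounded Kc.
pose B := `|M| + 1; have MB : M < B by rewrite ltr_pwDr// ler_norm.
have B0 : 0 <= B by rewrite addr_ge0.
exists (d%:R * B ^+ 2 + 1); first by rewrite addr_ge0// mulr_ge0// sqr_ge0.
move=> x Kx; rewrite /peval mevalB mevalC /sqr_norm rmorph_sum subr_gt0.
rewrite (le_lt_trans (y := \sum_(i < d) B ^+ 2))//; last first.
  by rewrite sumr_const card_ord mulr_natl ltrDl.
apply: ler_sum => i _; rewrite rmorphXn /= mevalXU -real_normK ?num_real//.
rewrite lerXn2r ?nnegrE// (le_trans _ (MK _ MB _ Kx))//.
by rewrite [leRHS]/Num.Def.normr /= mx_normrE; apply/bigmax_geP; right; exists (ord0, i).
Qed.

(** Every polynomial that is positive on the compact set belongs to the preordering;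
    a nonnegative p is the limit of the positive polynomials p + e. *)
Theorem positive_functional_ge0 (L : {linear A -> R^o}) (p : A) :
  positive_on (preordering f) L ->
  (forall x, semialgebraic_set f x -> 0 <= peval p x) -> 0 <= L p.
Proof.
move=> Lpos p0; have pT := preordering_precone f.
have [N N0 NK] := compact_sqr_norm.
have aT := woermann pT N0 (weak_positivstellensatz NK).
have L1 : 0 <= L 1 by apply: Lpos; exact: precone1.
have pos e : 0 < e -> 0 <= L p + e * L 1.
  move=> e0; have : 0 <= L (p + e *: 1).
    apply: Lpos; apply: (archimedean_positive pT aT); apply: weak_positivstellensatz.
    by move=> x Kx; rewrite /peval mevalD mevalZ meval1 mulr1 ltr_wpDl//; exact: p0.
  by rewrite linearD linearZ.
have L10 : 0 < L 1 + 1 by rewrite ltr_wpDl.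
apply/ler_addgt0Pr => e e0.
have := pos (e / (L 1 + 1)) (divr_gt0 e0 L10); rewrite -mulrA => /le_trans; apply.
rewrite lerD2l ger_pMr// mulrC ler_pdivrMr// mul1r lerDl.
exact: ler01.
Qed.

End Positivstellensatz.

(** * Extension of positive functionals to bounded functions *)

Section PositiveExtension.
Variables (R : realType) (T : Type) (K : set T).
Implicit Types (G : set ((T -> R) * R)) (g h : T -> R).

Definition bounded_on g := exists M, forall x, K x -> `|g x| <= M.

(** A partially defined linear functional is handled through its graph, so that
    extensions are ordered by inclusion and no subtype of functions is needed. *)
Definition linear_graph G := forall a g r h s, G (g, r) -> G (h, s) ->
  G ((fun x => a * g x + h x), a * r + s).

Definition positive_graph G := forall g r, G (g, r) ->
  (forall x, K x -> 0 <= g x) -> 0 <= r.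

Lemma linear_graph0 G g r : linear_graph G -> G (g, r) -> G (fun=> 0, 0).
Proof.
move=> Gl Gg; have := Gl (- 1) _ _ _ _ Gg Gg.
by rewrite mulN1r addNr; congr (G (_, _)); apply/funext => x; rewrite mulN1r addNr.
Qed.

Lemma linear_graphZ G a g r : linear_graph G -> G (g, r) -> G (fun x => a * g x, a * r).
Proof.
move=> Gl Gg; have := Gl a _ _ _ _ Gg (linear_graph0 Gl Gg).
by rewrite addr0; congr (G (_, _)); apply/funext => x; rewrite addr0.
Qed.

Lemma graph_le G g r h s : linear_graph G -> positive_graph G ->
  G (g, r) -> G (h, s) -> (forall x, K x -> g x <= h x) -> r <= s.
Proof.
move=> Gl Gp Gg Gh gh; rewrite -subr_ge0 -[r]mul1r -mulNr addrC.
by apply: (Gp _ _ (Gl (- 1) _ _ _ _ Gg Gh)) => x Kx; rewrite mulN1r addrC subr_ge0 gh.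
Qed.

(** Hahn-Banach for positive functionals. On a new bounded function g the value may
    be any number between the values on the functions below g and on those above;
    both kinds exist because the constants are in the domain. *)
Lemma positive_graph_extension G0 m : linear_graph G0 -> positive_graph G0 ->
  G0 (fun=> 1, m) ->
  exists G, [/\ (G0 `<=` G)%classic, linear_graph G, positive_graph G &
    forall g, bounded_on g -> exists r, G (g, r)].
Proof.
move=> G0l G0p G01.
have [||G [G0G [Gl Gp] Gmax]] :=
  @Zorn_above _ [set G | linear_graph G /\ positive_graph G]%classic G0.
- by [].
- move=> F FP Ftot [X FX]; split=> [a g r h s [Y FY Yg] [Z FZ Zh]|g r [Y FY]].
    have [YZ|ZY] := Ftot _ _ FY FZ.
      by exists Z => //; apply: (FP Z FZ).1 => //; exact: YZ.
    by exists Y => //; apply: (FP Y FY).1 => //; exact: ZY.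
  exact: (FP Y FY).2.
exists G; split => // g [M gM].
have Gc c : G (fun=> c, c * m).
  by have := linear_graphZ c Gl (G0G _ G01); under eq_fun do rewrite mulr1.
pose S := [set r | exists h, G (h, r) /\ forall x, K x -> h x <= g x]%classic.
have S0 : (S !=set0)%classic.
  exists (- M * m), (fun=> - M); split => // x Kx.
  by have := gM x Kx; rewrite ler_norml => /andP[].
have Sub h s : G (h, s) -> (forall x, K x -> g x <= h x) -> ubound S s.
  move=> Gh gh r [u [Gu ug]]; apply: (graph_le Gl Gp Gu Gh) => x Kx.
  exact: le_trans (ug _ Kx) (gh _ Kx).
have hS : has_sup S.
  split => //; exists (M * m); apply: (Sub (fun=> M)) => // x Kx.
  by have := gM x Kx; rewrite ler_norml => /andP[].
pose r0 := sup S.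
pose G' : set ((T -> R) * R) := [set z | exists t h s, [/\ G (h, s),
   z.1 = (fun x => t * g x + h x) & z.2 = t * r0 + s]]%classic.
have G'G : G' = G.
  apply: Gmax.
    move=> [h s] Ghs; exists 0, h, s; split => //=; last by rewrite mul0r add0r.
    by apply/funext => x; rewrite mul0r add0r.
  split.
    move=> a _ _ _ _ [t [h [s [Gh /= -> ->]]]] [t' [h' [s' [Gh' /= -> ->]]]].
    exists (a * t + t'), (fun x => a * h x + h' x), (a * s + s').
    split => /=; [exact: Gl|by apply/funext => x; ring|by ring].
  move=> _ _ [t [h [s [Gh /= -> ->]]]] pos.
  have [t0|t0|t0] := ltgtP t 0.
  - have : r0 <= (- t)^-1 * s.
      apply: ge_sup => //; apply: (Sub _ _ (linear_graphZ _ Gl Gh)) => x Kx.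
      rewrite mulrC ler_pdivlMr ?oppr_gt0// mulrN mulrC -subr_ge0 opprK addrC.
      exact: pos.
    by rewrite mulrC ler_pdivlMr ?oppr_gt0// mulrN mulrC -subr_ge0 opprK addrC.
  - have : t^-1 * - s <= r0.
      apply: sup_upper_bound => //; exists (fun x => t^-1 * - h x); split.
        have := linear_graphZ (- t^-1) Gl Gh; rewrite mulNr mulrN.
        by congr (G (_, _)); apply/funext => x; rewrite mulNr mulrN.
      move=> x Kx; rewrite ler_pdivrMl// -subr_ge0 opprK; exact: pos.
    by rewrite ler_pdivrMl// -subr_ge0 opprK.
  - rewrite t0 mul0r add0r; apply: (Gp _ _ Gh) => x Kx.
    by have := pos x Kx; rewrite t0 mul0r add0r.
exists r0; rewrite -G'G; exists 1, (fun=> 0), 0; split => /=.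
- exact: linear_graph0 Gl (Gc 0).
- by apply/funext => x; rewrite mul1r addr0.
- by rewrite mul1r addr0.
Qed.

Record positive_functional (Lam : (T -> R) -> R) : Prop := PositiveFunctional {
  pfunctional_linear : forall a g h, bounded_on g -> bounded_on h ->
    Lam (fun x => a * g x + h x) = a * Lam g + Lam h;
  pfunctional_ge0 : forall g, bounded_on g -> (forall x, K x -> 0 <= g x) ->
    0 <= Lam g }.

Lemma bounded_lin a g h : bounded_on g -> bounded_on h ->
  bounded_on (fun x => a * g x + h x).
Proof.
move=> [M gM] [N hN]; exists (`|a| * M + N) => x Kx.
rewrite (le_trans (ler_normD _ _))// lerD ?hN// normrM.
by rewrite ler_wpM2l// gM.
Qed.

Lemma positive_functional_extension G0 m : linear_graph G0 -> positive_graph G0 ->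
  G0 (fun=> 1, m) -> exists2 Lam, positive_functional Lam &
    forall g r, bounded_on g -> G0 (g, r) -> Lam g = r.
Proof.
move=> G0l G0p G01.
have [G [G0G Gl Gp Gdom]] := positive_graph_extension G0l G0p G01.
have uniq g r s : G (g, r) -> G (g, s) -> r = s.
  by move=> Gr Gs; apply/le_anti; rewrite !(graph_le Gl Gp Gr Gs, graph_le Gl Gp Gs Gr).
have /choice[Lam LamE] : forall g, exists r, bounded_on g -> G (g, r).
  move=> g; have [/Gdom[r Gr]|ng] := pselect (bounded_on g); first by exists r.
  by exists 0.
exists Lam; last by move=> g r bg /G0G Gr; exact: uniq (LamE _ bg) Gr.
split=> [a g h bg bh|g bg]; last exact: Gp (LamE _ bg).
exact: uniq (LamE _ (bounded_lin a bg bh)) (Gl _ _ _ _ _ (LamE _ bg) (LamE _ bh)).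
Qed.

End PositiveExtension.

(** * Push-forwards of Lebesgue measure *)

Section PushforwardLebesgue.
Local Open Scope classical_set_scope.
Variables (R : realType) (V : normedModType R) (Q : set R) (h : R -> V) (m : R).
Hypothesis Qcount : countable Q.
Hypothesis hcont : forall t, ~ Q t -> {for t, continuous h}.

Let hB : measurableTypeR R -> borelType V := h.

(** The preimage of an open set differs from its interior by a subset of Q. *)
Lemma measurable_cont_off_countable : measurable_fun setT hB.
Proof.
apply: (@measurability _ _ (measurableTypeR R) (borelType V) setT hB (@open V)) => //.
move=> _ [U oU <-]; rewrite setTI.
pose E := h @^-1` U.
have -> : hB @^-1` U = E^° `|` (E `\` E^°).
  by rewrite setDUK//; exact: interior_subset.
apply: measurableU; first by apply: measurable_realfun.open_measurable; exact: open_interior.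
apply: countable_measurable; first by move=> t; exact: measurable_set1.
apply: sub_countable Qcount; apply: subset_card_le => t [Et nt].
apply: contrapT => nQt; apply: nt; apply: hcont => //.
exact: open_nbhs_nbhs.
Qed.

Definition itv0 := `[0, m[%classic : set (measurableTypeR R).

Lemma measurable_itv0 : measurable itv0.
Proof. exact: measurable_itv. Qed.

Definition lebesgue0 : {measure set (measurableTypeR R) -> \bar R} :=
  mrestr lebesgue_measure measurable_itv0.

Definition push_lebesgue : {measure set (borelType V) -> \bar R} :=
  measure_function_pushforward__canonical__measure_function_Measure lebesgue0
    measurable_cont_off_countable.

Lemma lebesgue0_setT : lebesgue0 setT = (Num.max 0 m)%:E.
Proof.
rewrite /lebesgue0 /= /mrestr setTI lebesgue_measure_itv /= lte_fin.
by rewrite sube0 /Num.max; case: ifP.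
Qed.

Lemma lebesgue0_lty A : measurable A -> (lebesgue0 A < +oo)%E.
Proof.
move=> mA; have h1 : (lebesgue0 A <= lebesgue0 setT)%E.
  by apply: le_measure; rewrite ?inE.
by apply: le_lt_trans h1 _; rewrite lebesgue0_setT ltry.
Qed.

Lemma push_lebesgueE A : push_lebesgue A = lebesgue_measure (h @^-1` A `&` itv0).
Proof. by []. Qed.

Lemma closed_borel_measurable (C : set V) : closed C -> measurable (C : set (borelType V)).
Proof.
move=> cC; rewrite -[C]setCK; apply: measurableC; apply: sub_sigma_algebra.
exact: closed_openC.
Qed.

(** Off the null set Q the map h is continuous, so it carries the compact sets given
    by the inner regularity of Lebesgue measure to compact sets. *)
Lemma push_lebesgue_radon : radon push_lebesgue.
Proof.
have mpre A : measurable (A : set (borelType V)) -> measurable (hB @^-1` A).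
  by move=> mA; rewrite -[X in measurable X]setTI; exact: measurable_cont_off_countable.
have mcompact (C : set V) : compact C -> measurable (C : set (borelType V)).
  by move=> cC; apply: closed_borel_measurable; exact: (compact_closed (@norm_hausdorff _ V)).
split=> [C cC|A mA].
  by apply: lebesgue0_lty; apply: mpre; exact: mcompact.
apply/eqP; rewrite eq_le; apply/andP; split; last first.
  apply: ge_ereal_sup => _ [C [cC CA] <-]; apply: le_measure => //; rewrite inE//.
  exact: mcompact.
apply/lee_addgt0Pr => e e0.
pose D := (hB @^-1` A `&` itv0) `\` Q.
have mQ : measurable (Q : set (measurableTypeR R)).
  by apply: countable_measurable => // t; exact: measurable_set1.
have mD : measurable D.
  by apply: measurableD => //; apply: measurableI; [exact: mpre|exact: measurable_itv0].
have AD : push_lebesgue A = lebesgue_measure D.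
  rewrite push_lebesgueE (@measureDI _ _ _ lebesgue_measure _ Q)//; last first.
    by apply: measurableI; [exact: mpre|exact: measurable_itv0].
  rewrite [X in (_ + X)%E](_ : _ = 0%E) ?adde0//.
  apply: countable_lebesgue_measure0.
  by apply: sub_countable Qcount; apply: subset_card_le; exact: subIsetr.
have Dfin : (lebesgue_measure D < +oo)%E.
  by rewrite -AD; apply: lebesgue0_lty; exact: mpre.
have [E [cE ED DE]] := lebesgue_regularity_inner mD Dfin e0.
have mE : measurable (E : set (measurableTypeR R)) by exact: measurable_realfun.compact_measurable.
have chE : compact (h @` E).
  apply: continuous_compact => //; apply: continuous_in_subspaceT => t tE.
  by apply: hcont; have := ED t; rewrite inE in tE; move=> /(_ tE)[].
rewrite AD -(setDUK ED) measureU//; last 2 first.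
- exact: measurableD.
- by rewrite setDIK.
apply: leeD; last exact: ltW.
apply: (@le_trans _ _ (push_lebesgue (h @` E))).
  rewrite push_lebesgueE; apply: le_measure; rewrite ?inE//.
    by apply: measurableI; [apply: mpre; exact: mcompact|exact: measurable_itv0].
  by move=> t Et; split; [exists t|have [[_ ?] _] := ED t Et].
apply: ereal_sup_ubound; exists (h @` E) => //; split => // _ [t Et <-].
by have [[]] := ED t Et.
Qed.

End PushforwardLebesgue.

(** * The quantile map of a positive functional *)

Section FunctionalTheory.
Variables (R : realType) (T : Type) (K : set T) (Lam : (T -> R) -> R).
Hypothesis LamP : positive_functional K Lam.
Implicit Types g h : T -> R.

Lemma bounded_cst_on (a : R) : bounded_on K (fun=> a).
Proof. by exists `|a|. Qed.

Lemma bounded_mul g h : bounded_on K g -> bounded_on K h -> bounded_on K (fun x => g x * h x).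
Proof.
move=> [M gM] [N hN]; exists (M * N) => x Kx.
by rewrite normrM ler_pM// ?gM ?hN.
Qed.

Lemma pfunctionalD g h : bounded_on K g -> bounded_on K h ->
  Lam (fun x => g x + h x) = Lam g + Lam h.
Proof.
move=> bg bh; rewrite -[Lam g]mul1r -(pfunctional_linear LamP)//.
by congr Lam; apply/funext => x; rewrite mul1r.
Qed.

Lemma pfunctional0 : Lam (fun=> 0) = 0.
Proof.
have b0 := bounded_cst_on 0; have := pfunctionalD b0 b0.
rewrite (_ : (fun=> 0 + 0) = fun=> 0); last by apply/funext => x; rewrite addr0.
by move/eqP; rewrite -subr_eq0 opprD addrA subrr sub0r oppr_eq0 => /eqP.
Qed.

Lemma pfunctionalZ a g : bounded_on K g -> Lam (fun x => a * g x) = a * Lam g.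
Proof.
move=> bg; have := pfunctional_linear LamP a bg (bounded_cst_on 0).
by rewrite pfunctional0 addr0 => <-; congr Lam; apply/funext => x; rewrite addr0.
Qed.

Lemma pfunctional_le g h : bounded_on K g -> bounded_on K h ->
  (forall x, K x -> g x <= h x) -> Lam g <= Lam h.
Proof.
move=> bg bh gh; rewrite -subr_ge0 -[Lam g]mul1r -mulNr addrC -(pfunctional_linear LamP)//.
apply: (pfunctional_ge0 LamP); first exact: bounded_lin.
by move=> x Kx; rewrite mulN1r addrC subr_ge0 gh.
Qed.

Lemma pfunctional_eq g h : bounded_on K g -> bounded_on K h ->
  (forall x, K x -> g x = h x) -> Lam g = Lam h.
Proof. by move=> bg bh gh; apply/le_anti; rewrite !pfunctional_le// => x Kx; rewrite gh. Qed.

End FunctionalTheory.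

Section Quantile.
Local Open Scope classical_set_scope.
Variables (R : realType) (V : normedModType R) (K : set V).
Hypothesis Kcompact : compact K.
Implicit Types x y : V.

Lemma compact_seq_cluster (u : nat -> V) : (forall n, K (u n)) ->
  exists2 p, K p & forall e n, 0 < e -> exists2 j, (n <= j)%N & `|p - u j| < e.
Proof.
move=> Ku; have [p [Kp cp]] : K `&` cluster (u @ \oo) !=set0.
  by apply: Kcompact; exists 0%N => // n _; exact: Ku.
exists p => // e n e0.
have [|_ [[j /= nj <-]]] := cp [set u j | j in [set j | (n <= j)%N]] _ _ (nbhsx_ballx p _ e0).
  by exists n => // j /= nj; exists j.
by rewrite -ball_normE /ball_ /= => pj; exists j.
Qed.

Lemma compact_net e : 0 < e ->
  exists s : seq V, forall x, K x -> has (fun y => `|x - y| < e) s.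
Proof.
move=> e0; have := Kcompact; rewrite compact_cover => /(_ V K (fun y => ball y e)).
case=> [y _||D DK KD]; first exact: ball_open.
  by move=> x Kx; exists x => //; exact: ballxx.
exists (finmap.enum_fset D) => x /KD[y yD xy]; apply/hasP; exists y => //.
by move: xy; rewrite -ball_normE /ball_ /= distrC.
Qed.

Definition mesh (n : nat) : R := n.+1%:R^-1.

Lemma mesh_small (e : R) : 0 < e -> exists n, mesh n < e.
Proof.
move=> e0; exists (Num.bound e^-1); rewrite /mesh invf_plt ?posrE//.
have ei : 0 <= e^-1 by rewrite invr_ge0 ltW.
by apply: lt_le_trans (archi_boundP ei) _; rewrite ler_nat.
Qed.

Lemma mesh_mono n j : (n <= j)%N -> mesh j <= mesh n.
Proof. by move=> nj; rewrite /mesh lef_pV2 ?posrE// ler_nat. Qed.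

Section Code.
Variable s : nat -> seq V.
Hypothesis sP : forall n x, K x -> has (fun y => `|x - y| < mesh n) (s n).

Definition digit n x := find (fun y => `|x - y| < mesh n) (s n).
Definition base n := (size (s n)).+1.
(** The first n digits of x, read as one integer in mixed radix; the digits of x
    locate it in finer and finer finite nets of K. Codes of consecutive levels are
    related by Euclidean division, which turns nested cells into nested intervals. *)
Fixpoint code n x := if n is n'.+1 then (code n' x * base n' + digit n' x)%N else 0%N.
Fixpoint code_bound n := if n is n'.+1 then (code_bound n' * base n')%N else 1%N.

Lemma digit_lt n x : (digit n x < base n)%N.
Proof. by rewrite ltnS find_size. Qed.

Lemma code_div n x : (code n.+1 x %/ base n)%N = code n x.
Proof. by rewrite /= divnMDl// divn_small ?addn0// digit_lt. Qed.

Lemma code_mod n x : (code n.+1 x %% base n)%N = digit n x.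
Proof. by rewrite /= modnMDl modn_small// digit_lt. Qed.

Lemma code_lt n x : (code n x < code_bound n)%N.
Proof. by elim: n => //= n IHn; rewrite -ltn_divLR// code_div. Qed.

Lemma code_close n x y : K x -> K y -> code n.+1 x = code n.+1 y ->
  `|x - y| < 2 * mesh n.
Proof.
move=> Kx Ky cxy; have : digit n x = digit n y by rewrite -!code_mod cxy.
have := nth_find x (sP n Kx); have := nth_find x (sP n Ky).
rewrite -!/(digit n _) => + + dxy; rewrite dxy => yz xz.
by rewrite (le_lt_trans (ler_distD (nth x (s n) (digit n y)) _ _))// mulr2n mulrDl mul1r ltrD// distrC.
Qed.

Variable Lam : (V -> R) -> R.
Hypothesis LamP : positive_functional K Lam.

Definition below n j : V -> R := fun x => (code n x < j)%N%:R.
Definition cumul n j := Lam (below n j).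
Definition mass := Lam (fun=> 1).

Lemma bounded_below n j : bounded_on K (below n j).
Proof. by exists 1 => x _; rewrite /below normr_nat; case: (_ < _)%N. Qed.

Lemma cumul0 n : cumul n 0 = 0.
Proof. by rewrite -(pfunctional0 LamP). Qed.

Lemma cumul_le n i j : (i <= j)%N -> cumul n i <= cumul n j.
Proof.
move=> ij; apply: (pfunctional_le LamP); [exact: bounded_below|exact: bounded_below|].
by move=> x _; rewrite /below ler_nat; case: ltnP => // /leq_trans -> .
Qed.

Lemma cumul_bound n : cumul n (code_bound n) = mass.
Proof. by congr Lam; apply/funext => x; rewrite /below code_lt. Qed.

Lemma cumul_ge0 n j : 0 <= cumul n j.
Proof. by rewrite -(cumul0 n) cumul_le. Qed.

Lemma cumul_le_mass n j : cumul n j <= mass.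
Proof.
apply: (pfunctional_le LamP); [exact: bounded_below|exact: bounded_cst_on|].
by move=> x _; rewrite /below; case: (_ < _)%N.
Qed.

Lemma cumul_refine n j : cumul n.+1 (j * base n) = cumul n j.
Proof.
by congr Lam; apply/funext => x; rewrite /below -ltn_divLR// code_div.
Qed.

Definition cell n t j := cumul n j <= t /\ t < cumul n j.+1.

Lemma cell_exists n t : 0 <= t -> t < mass -> exists j, cell n t j.
Proof.
move=> t0 tm; have ex : exists j, t < cumul n j.+1.
  exists (code_bound n).-1; rewrite prednK ?cumul_bound//.
  exact: (leq_ltn_trans (leq0n _) (code_lt n point)).
case: (ex_minnP ex) => j tj jmin; exists j; split => //.
case: j tj jmin => [|j] tj jmin; first by rewrite cumul0.
by rewrite leNgt; apply/negP => /jmin; rewrite ltnn.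
Qed.

Lemma cell_uniq n t i j : cell n t i -> cell n t j -> i = j.
Proof.
move=> [i1 i2] [j1 j2]; apply/eqP; rewrite eqn_leq; apply/andP; split.
  by rewrite leqNgt; apply/negP => /(cumul_le n)/(lt_le_trans j2)/(le_lt_trans i1); rewrite ltxx.
by rewrite leqNgt; apply/negP => /(cumul_le n)/(lt_le_trans i2)/(le_lt_trans j1); rewrite ltxx.
Qed.

Lemma cell_inhabited n t j : cell n t j -> exists2 x, K x & code n x = j.
Proof.
move=> [j1 j2]; apply/not_notP => nx.
have : cumul n j.+1 = cumul n j.
  apply: (pfunctional_eq LamP); [exact: bounded_below|exact: bounded_below|].
  move=> x Kx; rewrite /below ltnS leq_eqVlt.
  by have [cx|//] := eqVneq (code n x) j; case: nx; exists x.
by move=> e; move: (le_lt_trans j1 j2); rewrite e ltxx.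
Qed.

Lemma cell_div n t j : cell n.+1 t j -> cell n t (j %/ base n).
Proof.
move=> [j1 j2]; split.
  by rewrite -cumul_refine (le_trans _ j1)// cumul_le// leq_divM.
by rewrite -cumul_refine (lt_le_trans j2)// cumul_le// -ltn_divLR.
Qed.

Lemma cell_code n k t x : cell (k + n) t (code (k + n) x) -> cell n t (code n x).
Proof. by elim: k => // k IHk; rewrite addSn => /cell_div; rewrite code_div. Qed.

(** A level n cell containing t has positive mass, hence a point in K. These points
    cluster at some p, and points with the same code are close. *)
Lemma quantile_exists t : 0 <= t -> t < mass -> exists2 p, K p &
  forall n x, K x -> cell n.+1 t (code n.+1 x) -> `|x - p| <= 2 * mesh n.
Proof.
move=> t0 tm.
have /choice[u uP] : forall n, exists x, K x /\ cell n t (code n x).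
  by move=> n; have [j jc] := cell_exists n t0 tm;
     have [x Kx cx] := cell_inhabited jc; exists x; rewrite cx.
have [p Kp pP] := @compact_seq_cluster u (fun n => (uP n).1).
exists p => // n x Kx cx; apply/ler_addgt0Pr => e e0.
have [j nj pj] := pP e n.+1 e0.
have cj : cell n.+1 t (code n.+1 (u j)).
  by apply: (@cell_code _ (j - n.+1)); rewrite subnK//; exact: (uP j).2.
rewrite (le_trans (ler_distD (u j) _ _))// lerD//; last by rewrite distrC ltW.
by rewrite ltW// code_close//; [exact: (uP j).1|exact: cell_uniq cx cj].
Qed.

Variable x0 : V.
Hypothesis Kx0 : K x0.

(** The generalized inverse of the distribution function of the codes. The point x0
    is a default outside [0, mass). *)
Definition quantile t : V :=
  if pselect (0 <= t /\ t < mass) is left e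
  then s2val (cid2 (quantile_exists e.1 e.2)) else x0.

Lemma quantile_in t : K (quantile t).
Proof. by rewrite /quantile; case: pselect => // e; case: cid2. Qed.

Lemma quantile_close n t x : 0 <= t -> t < mass -> K x ->
  cell n.+1 t (code n.+1 x) -> `|x - quantile t| <= 2 * mesh n.
Proof.
move=> t0 tm Kx; rewrite /quantile; case: pselect => [e|[]//].
by case: cid2 => p /= _; apply.
Qed.

Lemma quantile_out t : ~ (0 <= t /\ t < mass) -> quantile t = x0.
Proof. by rewrite /quantile; case: pselect. Qed.

Definition cuts : set R := [set cumul nj.1 nj.2 | nj in [set: nat * nat]]%classic.

Lemma countable_cuts : countable cuts.
Proof. by apply: sub_countable (countableP [set: nat * nat]); exact: card_image_le. Qed.

(** Away from the cuts, t is interior to its cells of all levels, and the map is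
    nearly constant on a cell of high level. *)
Lemma quantile_continuous t : ~ cuts t -> {for t, continuous quantile}.
Proof.
move=> tQ; have tW n j : t <> cumul n j by move=> e; apply: tQ; exists (n, j).
have [t0|t0|t0] := ltgtP t 0; last by case: (tW 0%N 0%N); rewrite cumul0.
  have e : \forall t' \near t, quantile t' = quantile t.
    near=> t'; rewrite !quantile_out//; first by case; rewrite leNgt t0.
    case; rewrite leNgt; suff -> : t' < 0 by [].
    by near: t'; exact: lt_nbhsl.
  by apply: cvg_near_cst.
have [tm|tm|tm] := ltgtP t mass; last by case: (tW 0%N 1%N); rewrite tm -(cumul_bound 0).
  apply/cvgrPdist_lt => e e0.
  have [n ne] := mesh_small (divr_gt0 e0 (ltr0Sn R 3)).
  have [j [j1 j2]] := cell_exists n.+1 (ltW t0) tm.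
  have [x Kx cx] := cell_inhabited (conj j1 j2).
  have j1' : cumul n.+1 j < t by rewrite lt_neqAle j1 andbT; apply/eqP => h; exact: (tW n.+1 j).
  near=> t'.
  have t'0 : 0 < t' by near: t'; exact: lt_nbhsr.
  have t'm : t' < mass by near: t'; exact: lt_nbhsl.
  have c' : cell n.+1 t' j.
    by split; [apply: ltW; near: t'; exact: lt_nbhsr|near: t'; exact: lt_nbhsl].
  rewrite (le_lt_trans (ler_distD x _ _))//.
  have h1 : `|x - quantile t| <= 2 * mesh n by apply: quantile_close => //; rewrite ?ltW// cx.
  have h2 : `|x - quantile t'| <= 2 * mesh n by apply: quantile_close => //; rewrite ?ltW// cx.
  rewrite distrC; move: ne; rewrite ltr_pdivlMr// => ne.
  by apply: le_lt_trans (lerD h1 h2) _; lra.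
have e : \forall t' \near t, quantile t' = quantile t.
  near=> t'; rewrite !quantile_out//; first by case=> _; rewrite ltNge (ltW tm).
  case=> _; rewrite ltNge; suff -> : mass <= t' by [].
  by apply: ltW; near: t'; exact: lt_nbhsr.
by apply: cvg_near_cst.
Unshelve. all: by end_near. Qed.

End Code.
End Quantile.

(** * Integration against the quantile measure *)

Section ContinuousIntegral.
Local Open Scope classical_set_scope.
Variables (R : realType) (V : normedModType R) (K : set V).
Hypothesis Kcompact : compact K.

Lemma continuous_borel_measurable (phi : V -> R) : continuous phi ->
  measurable_fun setT (phi : borelType V -> R).
Proof.
move=> cphi; apply: (@measurability _ _ (borelType V) R setT phi (@measurable_realfun.RGenOpens.G R)) => //.
  exact: measurable_realfun.RGenOpens.measurableE.
move=> _ [_ [a [b ->] <-]]; rewrite setTI; apply: sub_sigma_algebra => /=.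
by move/continuousP : cphi; apply; exact: interval_open.
Qed.

Lemma compact_bounded_on (phi : V -> R) : continuous phi -> bounded_on K phi.
Proof.
move=> cphi; have : compact (phi @` K).
  by apply: continuous_compact => //; exact: continuous_subspaceT.
move=> /compact_bounded[M [_ MK]]; exists (M + 1) => x Kx.
by apply: (MK (M + 1)); [rewrite ltrDl|exists x].
Qed.

(** Uniform continuity on K, at the scale of one of the nets. *)
Lemma uniformly_close (phi : V -> R) e : continuous phi -> 0 < e ->
  exists n, forall x y, K x -> K y -> `|x - y| <= 2 * mesh R n -> `|phi x - phi y| <= e.
Proof.
move=> cphi e0; apply/not_notP => nH.
have /choice[u uP] : forall n, exists xy : V * V,
    [/\ K xy.1, K xy.2, `|xy.1 - xy.2| <= 2 * mesh R n & e < `|phi xy.1 - phi xy.2|].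
  move=> n; apply/not_notP => nu; apply: nH; exists n => x y Kx Ky xy.
  by rewrite leNgt; apply/negP => h; apply: nu; exists (x, y).
have [|p Kp pP] := @compact_seq_cluster _ _ _ Kcompact (fst \o u).
  by move=> n; case: (uP n).
have := cphi p; move=> /cvgrPdist_lt /(_ (e / 2) (divr_gt0 e0 (ltr0Sn R 1))).
move=> /nbhs_ballP[r /= r0 rP].
have [n nr] := mesh_small (divr_gt0 r0 (ltr0Sn R 3)).
have [j nj pj] := pP (r / 2) n (divr_gt0 r0 (ltr0Sn R 1)).
have [Kx Ky xy] := uP j; apply/negP; rewrite -leNgt.
have mj : mesh R j < r / 4 by apply: le_lt_trans (mesh_mono R nj) nr.
have h1 : `|phi p - phi (u j).1| < e / 2.
  apply: rP; rewrite -ball_normE /ball_ /=; apply: lt_trans pj _; lra.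
have h2 : `|phi p - phi (u j).2| < e / 2.
  apply: rP; rewrite -ball_normE /ball_ /=.
  apply: le_lt_trans (ler_distD (u j).1 _ _) _.
  by apply: lt_le_trans (ltr_leD pj xy) _; lra.
rewrite (le_trans (ler_distD (phi p) _ _))// distrC; lra.
Qed.

Variable s : nat -> seq V.
Hypothesis sP : forall n x, K x -> has (fun y => `|x - y| < mesh R n) (s n).
Variable Lam : (V -> R) -> R.
Hypothesis LamP : positive_functional K Lam.
Variable x0 : V.
Hypothesis Kx0 : K x0.

Local Notation m := (mass Lam).
Local Notation W := (cumul s Lam).
Local Notation h := (quantile Kcompact sP LamP x0).
Local Notation lam := (@lebesgue0 R m).

Let hQ := @quantile_continuous R V K Kcompact s sP Lam LamP x0.
Let hcount := @countable_cuts R V s Lam.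

(** The law of the quantile map under Lebesgue measure on [0, mass). *)
Definition quantile_measure := push_lebesgue m hcount hQ.

Let mass_ge0 : 0 <= m.
Proof. by rewrite -(cumul_bound s Lam 0) (cumul_ge0 s LamP). Qed.

Lemma lebesgue0_itv a b : 0 <= a -> a <= b -> b <= m ->
  lam `[a, b[ = (b - a)%:E.
Proof.
move=> a0 ab bm; rewrite /lebesgue0 /= /mrestr.
have -> : `[a, b[ `&` itv0 m = `[a, b[.
  apply/setIidPl => t; rewrite /itv0 /= !in_itv /= => /andP[t1 t2].
  by rewrite (le_trans a0 t1) (lt_le_trans t2 bm).
rewrite lebesgue_measure_itv /= lte_fin; move: ab; rewrite le_eqVlt.
by move=> /predU1P[->|ab]; [rewrite ltxx subrr|rewrite ab EFinB].
Qed.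

Variable phi : V -> R.
Hypothesis cphi : continuous phi.

Let f t := phi (h t).

Let mf : measurable_fun setT (f : measurableTypeR R -> R).
Proof.
apply: (@measurableT_comp _ _ _ (measurableTypeR R) (borelType V) R phi).
  exact: continuous_borel_measurable.
exact: (measurable_cont_off_countable hcount hQ).
Qed.

Lemma quantile_integrable D : measurable D -> lam.-integrable D (EFin \o f).
Proof.
move=> mD; apply: measurable_bounded_integrable => //.
- exact: lebesgue0_lty.
- exact: measurable_funTS.
have [M MK] := compact_bounded_on cphi.
exists M; split; first exact: num_real.
by move=> y My t _ /=; rewrite (le_trans (MK _ (quantile_in _ _ _ Kx0 t)))// ltW.
Qed.

Lemma quantile_cell_estimate n j v e D : 0 <= e ->
  measurable D -> lam D = (W n.+1 j.+1 - W n.+1 j)%:E ->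
  (forall t, D t -> `|v - f t| <= e) ->
  `|\int[lam]_(t in D) f t - v * (W n.+1 j.+1 - W n.+1 j)| <= e * (W n.+1 j.+1 - W n.+1 j).
Proof.
set w := W _ j.+1 - _ => e0 mD lD Dv.
have Dfin : (lam D < +oo)%E by rewrite lD ltry.
have ic c : lam.-integrable D (EFin \o (fun=> c : R)).
  apply: measurable_bounded_integrable => //; exact: bounded_cst.
have E c : \int[lam]_(t in D) c = c * w by rewrite Rintegral_cst// lD.
rewrite ler_distl -mulrBl -mulrDl -!E; apply/andP; split;
  apply: le_Rintegral => //; try exact: quantile_integrable.
  by move=> t /Dv; rewrite ler_distl => /andP[h1 h2]; lra.
by move=> t /Dv; rewrite ler_distl => /andP[h1 h2]; lra.
Qed.

Lemma functional_cell_estimate n j v e : 0 <= e ->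
  (forall x, K x -> code s n.+1 x = j -> `|v - phi x| <= e) ->
  `|Lam (fun x => (code s n.+1 x == j)%:R * phi x) - v * (W n.+1 j.+1 - W n.+1 j)|
    <= e * (W n.+1 j.+1 - W n.+1 j).
Proof.
move=> e0 Dv; pose I x : R := (code s n.+1 x == j)%:R.
have bI : bounded_on K I by exists 1 => x _; rewrite normr_nat; case: (_ == _).
have bphi := compact_bounded_on cphi.
have LI : Lam I = W n.+1 j.+1 - W n.+1 j.
  apply/eqP; rewrite eq_sym subr_eq -(pfunctionalD LamP bI (bounded_below _ _ _ _)).
  apply/eqP; congr Lam; apply/funext => x; rewrite /below /I ltnS leq_eqVlt.
  by case: ltngtP; rewrite ?addr0 ?add0r.
rewrite -LI ler_distl -mulrBl -mulrDl -!(pfunctionalZ LamP _ bI); apply/andP; split;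
  apply: (pfunctional_le LamP) => [||x Kx]; try (by apply: bounded_mul => //; exact: bounded_cst_on).
  rewrite /I; case: eqP => [/(Dv _ Kx)|_]; rewrite ?mulr0 ?mul0r// mulr1 mul1r.
  by rewrite ler_distl => /andP[h1 h2]; lra.
rewrite /I; case: eqP => [/(Dv _ Kx)|_]; rewrite ?mulr0 ?mul0r// mulr1 mul1r.
by rewrite ler_distl => /andP[h1 h2]; lra.
Qed.

(** Both sides are sums over cells. On one cell phi is within e of a constant, so
    the two contributions are within e times the mass of the cell of the same number. *)
Lemma quantile_integral_estimate n e j : 0 <= e ->
  (forall x y, K x -> K y -> `|x - y| <= 2 * mesh R n -> `|phi x - phi y| <= e) ->
  `|\int[lam]_(t in `[0, W n.+1 j[) f t - Lam (fun x => below s n.+1 j x * phi x)|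
    <= 2 * e * W n.+1 j.
Proof.
move=> e0 He; elim: j => [|j IHj].
  rewrite (cumul0 s LamP) mulr0 set_itvco0 Rintegral_set0.
  rewrite (_ : (fun=> _) = fun=> 0) ?(pfunctional0 LamP) ?subrr ?normr0//.
  by apply/funext => x; rewrite /below mul0r.
have bphi := compact_bounded_on cphi.
set w := W n.+1 j; set w' := W n.+1 j.+1.
have ww : w <= w' by apply: (cumul_le s LamP).
have w0 : 0 <= w by exact: (cumul_ge0 s LamP).
have wm : w' <= m by exact: (cumul_le_mass s LamP).
pose D := `[w, w'[ : set (measurableTypeR R).
have mD : measurable D by exact: measurable_itv.
have lD : lam D = (w' - w)%:E by rewrite /D lebesgue0_itv.
have U : `[0, w'[ = `[0, w[ `|` D.
  apply/seteqP; split => t /=; rewrite !in_itv /=.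
    move=> /andP[t0 tw'].
    have [tw|tw] := ltP t w; [left|right]; rewrite ?/D /= ?in_itv /= ?t0 ?tw//.
  move=> []; rewrite ?/D /= ?in_itv /= => /andP[t1 t2].
    by rewrite t1 (lt_le_trans t2).
  by rewrite t2 (le_trans w0).
have split1 : \int[lam]_(t in `[0, w'[) f t =
    \int[lam]_(t in `[0, w[) f t + \int[lam]_(t in D) f t.
  rewrite U Rintegral_setU//.
    by apply: quantile_integrable; apply: measurableU => //; exact: measurable_itv.
  rewrite disj_set2E; apply/eqP; rewrite -subset0 => t [] /=.
  by rewrite !in_itv /= => /andP[_ t1] /andP[t2 _]; move: (lt_le_trans t1 t2); rewrite ltxx.
pose g x : R := (code s n.+1 x == j)%:R * phi x.
have bI : bounded_on K (fun x => (code s n.+1 x == j)%:R : R).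
  by exists 1 => x _; rewrite normr_nat; case: (_ == _).
have split2 : Lam (fun x => below s n.+1 j.+1 x * phi x) =
    Lam (fun x => below s n.+1 j x * phi x) + Lam g.
  rewrite -(pfunctionalD LamP); last 2 first.
  - by apply: bounded_mul => //; exact: bounded_below.
  - exact: bounded_mul.
  congr Lam; apply/funext => x; rewrite /g -mulrDl /below ltnS leq_eqVlt.
  by congr (_ * _); case: ltngtP; rewrite ?addr0 ?add0r.
have [v [v1 v2]] : exists v, (forall t, D t -> `|v - f t| <= e) /\
    (forall x, K x -> code s n.+1 x = j -> `|v - phi x| <= e).
  have [[x Kx cx]|nx] := pselect (exists2 x, K x & code s n.+1 x = j); last first.
    exists 0; split => [t|x Kx cx]; last by case: nx; exists x.
    rewrite /D /= in_itv /= => /andP[t1 t2]; case: nx.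
    exact: (@cell_inhabited _ _ _ s _ LamP n.+1 t j).
  exists (phi x); split => [t Dt|y Ky cy]; apply: He => //.
  - exact: quantile_in.
  - move: Dt; rewrite /D /= in_itv /= => /andP[t1 t2].
    apply: quantile_close => //; first exact: le_trans w0 t1.
      exact: lt_le_trans t2 wm.
    by rewrite cx.
  - by apply: ltW; apply: (code_close sP) => //; rewrite cx cy.
have := quantile_cell_estimate e0 mD lD v1.
have := functional_cell_estimate e0 v2.
rewrite -/w -/w' split1 split2 -/g.
move: IHj; rewrite -/w !ler_distl; set X := Lam g; set Y := Lam _.
set A := \int[lam]_(t in _) _; set B := \int[lam]_(t in D) _.
move=> /andP[a1 a2] /andP[b1 b2] /andP[c1 c2].
by apply/andP; split; lra.
Qed.

(** At the last code of a level the estimate compares the full integral with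
    Lam phi, and e is arbitrary. *)
Theorem quantile_integral :
  \int[lam]_(t in itv0 m) f t = Lam phi.
Proof.
apply/eqP; rewrite -subr_eq0 -normr_eq0 eq_le normr_ge0 andbT.
apply/ler_addgt0Pr => e e0; rewrite add0r.
have m1 : 0 < 2 * (m + 1) by rewrite mulr_gt0// ltr_wpDl.
have [n nP] := uniformly_close cphi (divr_gt0 e0 m1).
have := quantile_integral_estimate (code_bound s n.+1) (ltW (divr_gt0 e0 m1)) nP.
rewrite (cumul_bound s Lam n.+1) -/(itv0 m).
rewrite (_ : (fun x => below s n.+1 _ x * phi x) = phi); last first.
  by apply/funext => x; rewrite /below code_lt mul1r.
move=> /le_trans; apply; have m2 : 0 < m + 1 by rewrite ltr_wpDl.
have -> : 2 * (e / (2 * (m + 1))) * m = e * (m / (m + 1)) by field; rewrite gt_eqF.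
by rewrite ger_pMr// ler_pdivrMr// mul1r lerDl ler01.
Qed.

Theorem quantile_measure_integral :
  quantile_measure.-integrable setT (EFin \o phi) /\
  (\int[quantile_measure]_x (phi x)%:E)%E = (Lam phi)%:E.
Proof.
have mh := measurable_cont_off_countable hcount hQ.
have mphi : measurable_fun [set: borelType V] (EFin \o phi).
  by apply/measurable_EFinP; exact: continuous_borel_measurable.
have intf : lam.-integrable (h @^-1` setT) ((EFin \o phi) \o h).
  by rewrite preimage_setT; exact: quantile_integrable.
split; first exact: (integrable_pushforward mh mphi intf).
rewrite (integral_pushforward mh mphi intf)// preimage_setT.
have mN : measurable (~` itv0 m) by apply: measurableC; exact: measurable_itv0.
have lN : lam (~` itv0 m) = 0%E by rewrite /lebesgue0 /= /mrestr setICl measure0.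
rewrite (@negligible_integral _ _ _ lam setT (~` itv0 m))//.
rewrite setTD setCK -quantile_integral /Rintegral fineK//.
by apply: integrable_fin_num; [exact: measurable_itv0|by apply: quantile_integrable; exact: measurable_itv0].
Qed.

End ContinuousIntegral.

(** * Representing measures *)

Section RieszRepresentation.
Local Open Scope classical_set_scope.

(** A finitely additive positive functional on bounded functions agrees with an
    integral on the continuous ones. The values of Lam on discontinuous functions
    serve only to distribute its mass among the cells of finite partitions of K. *)
Theorem compact_representation (R : realType) (V : normedModType R) (K : set V)
    (Lam : (V -> R) -> R) : compact K -> positive_functional K Lam ->
  exists mu : {measure set (borelType V) -> \bar R},
    [/\ radon mu, mu (~` K) = 0%E &
      forall phi : V -> R, continuous phi ->
        mu.-integrable setT (EFin \o phi) /\
        (\int[mu]_x (phi x)%:E)%E = (Lam phi)%:E].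
Proof.
move=> Kc LamP.
have /choice[s sP] : forall n, exists s : seq V,
    forall x, K x -> has (fun y => `|x - y| < mesh R n) s.
  by move=> n; apply: compact_net => //; rewrite invr_gt0.
have [[x0 Kx0]|K0] := pselect (exists x, K x).
  exists (quantile_measure Kc sP LamP x0); split.
  - exact: push_lebesgue_radon.
  - rewrite /quantile_measure push_lebesgueE.
    rewrite (_ : _ @^-1` _ = set0) ?set0I ?measure0// -subset0 => t /=; apply.
    exact: quantile_in.
  - by move=> phi cphi; exact: quantile_measure_integral.
exists mzero; split.
- split=> [C _|A mA]; first by rewrite /mzero ltry.
  apply/eqP; rewrite eq_le; apply/andP; split.
    by apply: ereal_sup_ubound; exists set0 => //; split => //; exact: compact0.
  by apply: ge_ereal_sup => _ [C _ <-].
- by [].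
- move=> phi cphi; split; last first.
    rewrite integral_measure_zero; congr EFin.
    rewrite -(pfunctional0 LamP); apply: (pfunctional_eq LamP).
    + by exists 0 => x Kx; case: K0; exists x.
    + by exists 0 => x Kx; case: K0; exists x.
    + by move=> x Kx; case: K0; exists x.
  apply/integrableP; split; last by rewrite integral_measure_zero ltry.
  by apply/measurable_EFinP; exact: continuous_borel_measurable.
Qed.

End RieszRepresentation.

Lemma continuous_peval (R : realType) (d : nat) (p : mpoly d R) :
  continuous (peval p : 'rV[R]_d -> R).
Proof.
have -> : peval p = fun x : 'rV[R]_d => \sum_(m <- msupp p)
    mcoeff m p * \prod_i x ord0 i ^+ m i by apply/funext => x; exact: mevalE.
elim: (msupp p) => [|m s IHs] x.
  by rewrite (_ : (fun=> _) = fun=> 0); [exact: cst_continuous|apply/funext => y; rewrite big_nil].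
rewrite (_ : (fun=> _) = (fun y : 'rV[R]_d => mcoeff m p * \prod_i y ord0 i ^+ m i) \+
   (fun y => \sum_(j <- s) mcoeff j p * \prod_i y ord0 i ^+ j i)); last first.
  by apply/funext => y; rewrite big_cons.
apply: (@continuousD _ _ _ _ _ x); last exact: IHs.
apply: (@continuousM _ _ _ _ x); first exact: cst_continuous.
elim: (index_enum _) => [|i r IHr].
  by rewrite (_ : (fun=> _) = fun=> 1); [exact: cst_continuous|apply/funext => y; rewrite big_nil].
rewrite (_ : (fun=> _) = (fun y : 'rV[R]_d => y ord0 i ^+ m i) \*
   (fun y => \prod_(j <- r) y ord0 j ^+ m j)); last first.
  by apply/funext => y; rewrite big_cons.
apply: (@continuousM _ _ _ _ x); last exact: IHr.
elim: (m i) => [|e IHe].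
  by rewrite (_ : (fun=> _) = fun=> 1); [exact: cst_continuous|apply/funext => y; rewrite expr0].
rewrite (_ : (fun=> _) = (fun y : 'rV[R]_d => y ord0 i) \* (fun y => y ord0 i ^+ e)); last first.
  by apply/funext => y; rewrite exprS.
apply: (@continuousM _ _ _ _ x); last exact: IHe.
exact: coord_continuous.
Qed.

Theorem theorem12p29 (R : realType) (d k : nat) (f : 'I_k -> mpoly d R)
    (L : {linear mpoly d R -> R^o}) :
  compact (semialgebraic_set f) ->
  positive_on (preordering f) L ->
  moment_functional (semialgebraic_set f) L.
Proof.
move=> Kc Lpos.
pose G : set (('rV[R]_d -> R) * R) :=
  [set (peval p, L p : R) | p in [set: mpoly d R]]%classic.
have Gl : linear_graph G.
  move=> a _ _ _ _ [p _ [<- <-]] [q _ [<- <-]]; exists (a *: p + q) => //.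
  rewrite linearP; congr (_, _); apply/funext => x.
  by rewrite /peval mevalD mevalZ.
have Gp : positive_graph (semialgebraic_set f) G.
  by move=> _ _ [p _ [<- <-]]; exact: positive_functional_ge0.
have G1 : G (fun=> 1, L 1 : R).
  by exists 1 => //; congr (_, _); apply/funext => x; rewrite /peval meval1.
have [Lam LamP LamL] := positive_functional_extension Gl Gp G1.
have [mu [muR muK muI]] := compact_representation Kc LamP.
exists mu; split => // p; have [ip Ip] := muI _ (@continuous_peval R d p); first exact: ip.
rewrite Ip (LamL _ (L p : R))//; last by exists p.
exact: compact_bounded_on (@continuous_peval R d p).
Qed.
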